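(* There is an absolute constant $C>0$ such that the following holds. Let $\mathcal H$ be a real Hilbert space and let $T:\mathcal H\to\mathcal H$ be nonexpansive with $\operatorname{Fix}T=\{x\in\mathcal H: Tx=x\}\neq\varnothing$. Let $K\ge 2$ be an integer, let $a$ satisfy $0<a\le \frac{K\log 2}{\log K}-1$, let $x_0,x_1\in\mathcal H$ be arbitrary and deterministic, and let $x_K,y_K,z_K$ be generated by the stochastic iKM iteration with the softplus-parameterized schedule $(\alpha_k,\beta_k,\lambda_k)_{k=1}^K$ with parameter $a$ (both defined in the context), under the stochastic oracle model of the context with noise level $\sigma\geq 0$ and accumulated root-mean-square bias $B_K<\infty$. Then $$\max_{v_K\in\{x_K,y_K,z_K\}}\left(\mathbb E\|v_K-Tv_K\|^2\right)^{1/2}\le C\left\{\frac{1+1/a}{K}\inf_{p^\star\in\operatorname{Fix}T}\|x_1-p^\star\|+(1+a)\left(\frac{\sigma\log K}{\sqrt K}+\frac{B_K\log K}{K}\right)\right\}.$$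
   Context: Nonexpansive means $\|Tx-Ty\|\le\|x-y\|$ for all $x,y\in\mathcal H$. Stochastic iKM iteration: for $k=1,\dots,K$, $$y_k=x_k+\alpha_k(x_k-x_{k-1}),\quad z_k=x_k+\beta_k(x_k-x_{k-1}),\quad x_{k+1}=(1-\lambda_k)y_k+\lambda_k\widehat T_k(z_k).$$ Stochastic oracle model: $\widehat T_k(z_k)=Tz_k+b_k+\xi_k$. There is a probability space with a filtration $(\mathcal F_k)_{k=1}^K$, $\mathcal F_k\subseteq\mathcal F_{k+1}$; all $\mathcal H$-valued random variables are strongly measurable. For $1\le k\le K-1$: $x_{k-1},x_k,y_k,z_k$ and the bias $b_k$ are $\mathcal F_k$-measurable, and $\xi_k$ (hence $\widehat T_k(z_k)$) is $\mathcal F_{k+1}$-measurable. The noise satisfies, for a finite constant $\sigma\ge0$, $\mathbb E[\xi_k\mid\mathcal F_k]=0$ and $\mathbb E[\|\xi_k\|^2\mid\mathcal F_k]\le\sigma^2$ almost surely, for $1\le k\le K$. The accumulated root-mean-square bias is $B_K=\sum_{k=1}^{K-1}(\mathbb E\|b_k\|^2)^{1/2}$. Softplus-parameterized schedule with parameter $a$: $$\omega_k=\log\left(1+K^{a-(a+1)k/K}\right)\ (0\le k\le K),$$ $$r_k=2\left(\frac{\omega_{k-1}}{\omega_k}-1\right),\qquad u_k=\frac{3r_k}{2(1+r_k)(2+r_k)}\quad(1\le k\le K),$$ $$\beta_1=0,\quad \beta_k=\frac{4}{3r_{k-1}}\ (2\le k\le K),\qquad \lambda_k=\frac{K r_k\omega_{k-1}}{4(1+1/a)\omega_0}\,u_k,\quad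 \alpha_k=\frac{u_k-\lambda_k}{1-\lambda_k}\,\beta_k\quad(1\le k\le K).$$ *)

(* Defs.v *)
From mathcomp Require Export all_boot all_order all_algebra.
From mathcomp Require Export all_classical all_reals all_analysis.
From mathcomp Require Export sesquilinear measurable_realfun.
Export numFieldNormedType.Exports.

Set Implicit Arguments.
Unset Strict Implicit.
Unset Printing Implicit Defensive.

Local Open Scope classical_set_scope.
Local Open Scope ring_scope.

Section Operator.
Context {R : realType} {H : normedModType R}.
Implicit Type T : H -> H.

Definition nonexpansive T := forall x y, `|T x - T y| <= `|x - y|.

Definition Fix T : set H := [set p | T p = p].

End Operator.

(* Sub-sigma-algebras of the ambient one are represented by their families of
   events, [G : set (set Omega)]; [G := measurable] gives the ambient one. *)
Section BochnerConditionalExpectation.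
Context {d : measure_display} {Omega : measurableType d} {R : realType}
  {H : normedModType R}.
Variable P : probability Omega R.
Implicit Types (G : set (set Omega)) (A : set Omega).

Definition simple_wrt G (s : Omega -> H) :=
  finite_set (range s) /\ forall h, G (s @^-1` [set h]).

(* Everywhere (not merely almost everywhere) pointwise limits of simple
   functions. *)
Definition strongly_measurable G (f : Omega -> H) :=
  exists s : nat -> Omega -> H,
    (forall n, simple_wrt G (s n)) /\ forall w, s n w @[n --> \oo] --> f w.

Definition simple_integral A (s : Omega -> H) : H :=
  \sum_(h \in range s) fine (P (A `&` s @^-1` [set h])) *: h.

Definition bochner_integrable (f : Omega -> H) :=
  strongly_measurable measurable f /\ (\int[P]_w (`|f w|)%:E < +oo)%E.

Definition is_bochner_integral A (f : Omega -> H) (v : H) :=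
  exists s : nat -> Omega -> H,
    [/\ forall n, simple_wrt measurable (s n),
        (\int[P]_(w in A) (`|f w - s n w|)%:E)%E @[n --> \oo] --> 0%E
      & simple_integral A (s n) @[n --> \oo] --> v].

(* [g] is a version of [E[f | G]]. *)
Definition is_cond_expectation G (f g : Omega -> H) :=
  [/\ bochner_integrable f, bochner_integrable g, strongly_measurable G g
    & forall A, G A ->
        exists2 v, is_bochner_integral A f v & is_bochner_integral A g v].

(* [g] is a version of [E[f | G]] for a nonnegative [f], with values in
   [0, +oo]; no integrability is required. *)
Definition is_cond_expectation_ge0 G (f g : Omega -> \bar R) :=
  [/\ forall w, (0 <= g w)%E,
      forall B : set (\bar R), measurable B -> G (g @^-1` B)
    & forall A, G A -> (\int[P]_(w in A) g w = \int[P]_(w in A) f w)%E].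

(* (E ||f||^2)^(1/2), possibly +oo *)
Definition rms (f : Omega -> H) : \bar R :=
  sqrte ('E_P[(fun w => `|f w| ^+ 2)%R])%E.

End BochnerConditionalExpectation.

Section SoftplusSchedule.
Context {R : realType}.
Variables (K : nat) (a : R).
Implicit Type k : nat.

Definition sp_omega k : R :=
  ln (1 + K%:R `^ (a - (a + 1) * k%:R / K%:R)).

Definition sp_r k : R := 2 * (sp_omega k.-1 / sp_omega k - 1).

Definition sp_u k : R := 3 * sp_r k / (2 * (1 + sp_r k) * (2 + sp_r k)).

Definition sp_beta k : R :=
  if (k <= 1)%N then 0 else 4 / (3 * sp_r k.-1).

Definition sp_lambda k : R :=
  K%:R * sp_r k * sp_omega k.-1 / (4 * (1 + a^-1) * sp_omega 0%N) * sp_u k.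

Definition sp_alpha k : R :=
  (sp_u k - sp_lambda k) / (1 - sp_lambda k) * sp_beta k.

End SoftplusSchedule.

Section StochasticIKM.
Context {d : measure_display} {Omega : measurableType d} {R : realType}
  {H : normedModType R}.
Implicit Types (x y z b xi : nat -> Omega -> H) (That : nat -> Omega -> H -> H).

Definition stochastic_iKM (K : nat) (alpha beta lambda : nat -> R) That x y z :=
  forall k w, (1 <= k <= K)%N ->
  [/\ y k w = x k w + alpha k *: (x k w - x k.-1 w),
      z k w = x k w + beta k *: (x k w - x k.-1 w)
    & x k.+1 w = (1 - lambda k) *: y k w + lambda k *: That k w (z k w)].

Record stochastic_oracle (P : probability Omega R) (K : nat)
    (F : nat -> set (set Omega)) (T : H -> H) That x y z b xi (sigma : R)
    : Prop := StochasticOracle {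
  oracle_eq : forall k w, (1 <= k <= K)%N ->
    That k w (z k w) = T (z k w) + b k w + xi k w;
  oracle_sigma_algebra : forall k, (1 <= k <= K)%N ->
    sigma_algebra [set: Omega] (F k) /\ F k `<=` measurable;
  oracle_filtration : forall k, (1 <= k < K)%N -> F k `<=` F k.+1;
  oracle_measurable : forall k, (1 <= k <= K)%N ->
    [/\ strongly_measurable measurable (x k.-1),
        strongly_measurable measurable (x k),
        strongly_measurable measurable (x k.+1),
        strongly_measurable measurable (y k)
      & strongly_measurable measurable (z k)] /\
    [/\ strongly_measurable measurable (b k),
        strongly_measurable measurable (xi k)
      & strongly_measurable measurable (fun w => That k w (z k w))];
  oracle_adapted : forall k, (1 <= k < K)%N ->
    [/\ strongly_measurable (F k) (x k.-1), strongly_measurable (F k) (x k),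
        strongly_measurable (F k) (y k), strongly_measurable (F k) (z k)
      & strongly_measurable (F k) (b k)];
  oracle_noise_adapted : forall k, (1 <= k < K)%N ->
    strongly_measurable (F k.+1) (xi k) /\
    strongly_measurable (F k.+1) (fun w => That k w (z k w));
  oracle_noise_mean : forall k, (1 <= k <= K)%N ->
    is_cond_expectation P (F k) (xi k) (cst 0);
  (* Versions of a conditional expectation agree almost surely. *)
  oracle_noise_variance : forall k, (1 <= k <= K)%N ->
    exists2 g, is_cond_expectation_ge0 P (F k)
                 (fun w => (`|xi k w| ^+ 2)%:E) g
             & {ae P, forall w, (g w <= (sigma ^+ 2)%:E)%E} }.

Definition rms_bias (P : probability Omega R) (K : nat) b : \bar R :=
  (\sum_(1 <= k < K) rms P (b k))%E.

End StochasticIKM.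

(* Main.v *)
Require Import Defs.
From mathcomp Require Import finmap ring lra.

Set Implicit Arguments.
Unset Strict Implicit.
Unset Printing Implicit Defensive.

Import Order.TTheory GRing.Theory Num.Theory.

Local Open Scope classical_set_scope.
Local Open Scope ring_scope.

(* Let [G = id - T], which is cocoercive, [h_k = omega_(k-1) / omega_k - 1] and
   [c = K / (4 (1 + 1/a) omega_0)].  The schedule is the one for which
   [z_k = x_k - c omega_(k-1) W_k], where [W_k] is a weighted running average of
   the observed residuals [G z_j - b_j - xi_j], [j < k].  With the same weights,
   average the exact residuals [G z_j] and the points [z_j], the latter average
   being started at a fixed point; by cocoercivity the weighted covariance of
   [G z_j] and [z_j] is nonnegative (the "dispersion").  An energy that is
   quadratic in these averages plus the dispersion grows in one step by a factor
   at most [1 + 44 (h_k - h_(k-1)) + 2 tau_k], up to a bias term, a noise term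
   and a term of mean zero.  Since the softplus is log-concave, [h] is
   nondecreasing and bounded by [1], so the discrete Gronwall inequality costs an
   absolute constant.  Finally [z_K] can be added as one more point to the
   weighted family, so the residual at [z_K] is controlled by the energy at time
   [K]. *)

(** * The one-step energy inequality *)

(** The obstacle is accumulation over [K] steps. The product of the [1 + h_k] telescopes to
    [omega_0 / omega_K], which is at least of order [K], so a growth factor [1 + O(h_k)] would
    destroy the rate; only [h_k - h_(k-1)], whose sum is at most [1], may remain. Each term of first
    order in [h] must therefore cancel or be paid for by a contraction. Two squares contract: that
    of [rho = u + (1 - 2p) y], and that of the averaged error [nu], which has the large weight [400]
    for this reason. The square of the averaged residual [y] does not contract, so the coefficient
    of [<nu, y>] must be [O(h_k - h_(k-1))]; this dictates the shape of the cross term in the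
    energy. Distances are taken to the average of the [z_j] and not to the fixed point, because
    their interaction with [G z_k] is then cancelled exactly by the change of the dispersion. The
    weights [tau_k] stay free until the end; they are then taken proportional, up to a shift, to the
    root-mean-square biases, so that the square of their sum appears instead of [K] times the sum of
    their squares. *)

Section InnerProduct.
Context {R : realFieldType} {V : lmodType R} (ip : V -> V -> R).
Hypothesis ipC : forall u v, ip u v = ip v u.
Hypothesis ipDl : forall u v w, ip (u + v) w = ip u w + ip v w.
Hypothesis ipZl : forall a u v, ip (a *: u) v = a * ip u v.
Hypothesis ip_ge0 : forall u, 0 <= ip u u.

Lemma ipDr u v w : ip w (u + v) = ip w u + ip w v.
Proof. by rewrite ipC ipDl !(ipC w). Qed.
Lemma ipZr a u v : ip v (a *: u) = a * ip v u.
Proof. by rewrite ipC ipZl (ipC v). Qed.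
Lemma ipNl u v : ip (- u) v = - ip u v.
Proof. by rewrite -scaleN1r ipZl mulN1r. Qed.
Lemma ipNr u v : ip v (- u) = - ip v u.
Proof. by rewrite ipC ipNl (ipC v). Qed.

Definition ipE := (ipDl, ipDr, ipZl, ipZr, ipNl, ipNr).

Lemma ip_young (s : R) u v : 0 < s -> 2 * ip u v <= s * ip u u + s^-1 * ip v v.
Proof.
move=> s0; have := ip_ge0 (s *: u - v); rewrite !ipE (ipC v u) => h.
rewrite -subr_ge0.
have -> : s * ip u u + s^-1 * ip v v - 2 * ip u v =
  s^-1 * (s * (s * ip u u) + s * - ip u v + (- (s * ip u v) - - ip v v)).
  by field; rewrite gt_eqF.
by apply: mulr_ge0; [rewrite invr_ge0 ltW | lra].
Qed.

Lemma ip_youngN (s : R) u v : 0 < s ->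
  - (s * ip u u + s^-1 * ip v v) <= 2 * ip u v.
Proof.
move=> s0; have := ip_young (- u) v s0; rewrite !ipE => h; lra.
Qed.

(* [p] is the previous step [h_(k-1)], [d] the scaled dispersion, [y] the
   averaged observed residual and [nu] the averaged error; the cross term in [nu]
   cancels the first-order effect of the error on [u] and [y]. *)
Definition energy (p d : R) (u y nu : V) : R :=
  ip (u + (1 - 2 * p) *: y) (u + (1 - 2 * p) *: y) + (1 + p) ^+ 2 * ip y y
  + (1 + p) * d - 2 * (1 + p) * ip nu (u - (3 * p) *: y) + 400 * ip nu nu.

(** Since [u - 3p y = rho - (1 + p) y], the cross term splits in two, and Young with weights 8 and
    16 bounds it by at most [80 |nu|^2] and less than half of the other two squares; [400 - 80] is
    the 320. *)
Lemma energy_lower (p d : R) (u y nu : V) : 0 <= p <= 1 -> 0 <= d ->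
  2^-1 * ip (u + (1 - 2 * p) *: y) (u + (1 - 2 * p) *: y)
  + 2^-1 * ip y y + 320 * ip nu nu + d <= energy p d u y nu.
Proof.
move=> /andP[p0 p1] d0; rewrite /energy.
set rho := u + _.
have -> : u - (3 * p) *: y = rho - (1 + p) *: y.
  rewrite /rho -addrA -!(scaleNr _ y) -scalerDl; congr (_ + _ *: _); ring.
have h1 : 2 * ip nu rho <= 8 * ip nu nu + 8^-1 * ip rho rho by apply: ip_young.
have h2 : - (16 * ip nu nu + 16^-1 * ip y y) <= 2 * ip nu y by apply: ip_youngN.
have := ip_ge0 y; have := ip_ge0 nu; have := ip_ge0 rho.
rewrite [ip nu (rho - _)]ipDr ipNr ipZr.
move: (ip nu rho) (ip nu y) (ip rho rho) (ip y y) (ip nu nu) h1 h2 => rn ny rr yy nn h1 h2 rr0 nn0 yy0.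
have a1 : (1 + p) * (2 * rn) <= (1 + p) * (8 * nn + 8^-1 * rr) by rewrite ler_wpM2l//; lra.
have a2 : (1 + p) ^+ 2 * - (16 * nn + 16^-1 * yy) <= (1 + p) ^+ 2 * (2 * ny).
  by rewrite ler_wpM2l// sqr_ge0.
have a3 : 0 <= p * d by rewrite mulr_ge0.
have a4 : p * rr <= rr by rewrite ler_piMl.
have a5 : p * nn <= nn by rewrite ler_piMl.
have a6 : (1 + p) ^+ 2 * nn <= 4 * nn.
  rewrite ler_wpM2r//. nra.
have a7 : yy <= (1 + p) ^+ 2 * yy by rewrite ler_peMl//; nra.
nra.
Qed.

(* The coefficient of [xi] in the energy after one step: since it does not depend
   on [xi], the corresponding term has mean zero. *)
Definition step_noise (h p : R) (u y nu D b : V) : V :=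
  let q := (1 + h) / (1 + 2 * h) in
  let t := 2 * h / (1 + 2 * h) in
  - (16 * h ^+ 2 * q ^+ 2) *: (D - b + nu) - (4 * h * q ^+ 2) *: (u + 2 *: y)
  - (4 * h * q) *: (u - (3 * p) *: y)
  + (2 * q * t) *: (h *: (u + (1 - 2 * p) *: y) + ((h - p) * (3 + 4 * h)) *: y)
  + (800 * t) *: ((1 - t) *: nu + t *: b).

(** The products of [D] with [u + 2 *: y] coming from the squares cancel against the change of
    dispersion in [d']. What is left of [D] is a difference of two squares, whose sign depends only
    on the size of [h * k]. *)
Lemma energy_step_eq (h p d k : R) (u y nu D b xi : V) : 0 <= h -> 0 < k ->
  let q := (1 + h) / (1 + 2 * h) in
  let t := 2 * h / (1 + 2 * h) in
  let y' := (1 + 2 * h)^-1 *: (y + (2 * h) *: (D + y + nu - b - xi)) in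
  let nu' := (1 + 2 * h)^-1 *: (nu + (2 * h) *: (b + xi)) in
  let u' := (3 * h) *: y' + q *: (u - (4 * h) *: y) in
  let d' := q * (d - 2 * t * ip D (u + 2 *: y) - 2 * t / k * ip D D) in
  let rho := u + (1 - 2 * p) *: y in
  let chi := u - (3 * p) *: y in
  let nuh := (1 - t) *: nu + t *: b in
  let s := h *: rho + ((h - p) * (3 + 4 * h)) *: y in
  energy h d' u' y' nu' =
    q ^+ 2 * ip (rho - (2 * (h - p)) *: y) (rho - (2 * (h - p)) *: y)
    + (1 + h) ^+ 2 * ip y y + (1 + h) * q * d
    + (8 * h ^+ 2 * q ^+ 2 * ip (D - (b - nu)) (D - (b - nu)) - 4 * h * q ^+ 2 / k * ip D D)
    + 8 * h ^+ 2 * q ^+ 2 * ip xi xi - 4 * h * q ^+ 2 * ip (b - nu) (u + 2 *: y)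
    - 2 * (1 + h) * ip nu chi - 4 * h * q * ip (b - nu) chi + 2 * q * ip nuh s
    + 400 * ip nuh nuh + 400 * t ^+ 2 * ip xi xi + ip xi (step_noise h p u y nu D b).
Proof.
move=> h0 k0 /=; rewrite /energy /step_noise.
have h1 : 1 + 2 * h != 0 by rewrite gt_eqF//; lra.
rewrite !ipE (ipC y u) (ipC nu u) (ipC D u) (ipC b u) (ipC xi u) (ipC nu y)
  (ipC D y) (ipC b y) (ipC xi y) (ipC D nu) (ipC b nu) (ipC xi nu) (ipC b D)
  (ipC xi D) (ipC xi b).
field; rewrite h1 /= gt_eqF//.
Qed.

End InnerProduct.

(** * Bounds for the coefficients of the one-step expansion *)

Section Coefs.
Context {R : realFieldType}.
Variables (h p : R).
Hypotheses (p0 : 0 <= p) (ph : p <= h) (h1 : h <= 1).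
Let q := (1 + h) / (1 + 2 * h).
Let t := 2 * h / (1 + 2 * h).

Let h0 : 0 <= h. Proof. exact: le_trans ph. Qed.
Let ht : 0 < 1 + 2 * h. Proof. by move: (h0); lra. Qed.

Lemma step_q_gt0 : 0 < q. Proof. by rewrite divr_gt0//; move: (h0); lra. Qed.
Lemma step_q_le1 : q <= 1. Proof. by rewrite ler_pdivrMr//; move: (h0); lra. Qed.
Lemma step_t_ge0 : 0 <= t. Proof. by rewrite divr_ge0//; move: (h0); lra. Qed.
Lemma step_t_le1 : t <= 1. Proof. by rewrite ler_pdivrMr//; move: (h0); lra. Qed.
Lemma step_t_le : t <= 2 * h.
Proof. by rewrite ler_pdivrMr//; have := mulr_ge0 h0 h0; lra. Qed.
Lemma step_t_ge : 2 * h <= 3 * t.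
Proof.
rewrite mulrA ler_pdivlMr//.
have : 0 <= h * (1 - h) by rewrite mulr_ge0// subr_ge0.
lra.
Qed.
(** After clearing denominators the difference is a multiple of [h (1 - h) (13 + 20 h)], so there is
    equality at [h = 0] and [h = 1]. This decay of [|rho|^2] is the reserve that pays for
    [<nu, rho>]. *)
Lemma step_q2_le : q ^+ 2 <= 1 - 5 / 9 * h.
Proof.
rewrite expr_div_n ler_pdivrMr; last by rewrite exprn_gt0.
have : 0 <= h * (1 - h) * (13 + 20 * h).
  by rewrite !mulr_ge0// ?subr_ge0//; move: (h0); lra.
lra.
Qed.

Let e := h - p.
Let e0 : 0 <= e. Proof. by rewrite subr_ge0. Qed.
Let e1 : e <= 1. Proof. by rewrite /e; move: (p0) (h1); lra. Qed.

Let hq2 : 0 <= h * q ^+ 2 <= h * q.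
Proof.
have q0 := step_q_gt0; have q1 := step_q_le1.
by rewrite mulr_ge0 ?sqr_ge0//= ler_wpM2l// expr2 ler_piMl// ltW.
Qed.

Let hq1 : h * q <= h.
Proof. by rewrite ler_piMr// step_q_le1. Qed.

Let qt1 : 0 <= q * (1 - t) <= 1.
Proof.
have q0 := step_q_gt0; have q1 := step_q_le1.
have t0 := step_t_ge0; have t1 := step_t_le1.
have t2 : 0 <= 1 - t by rewrite subr_ge0.
rewrite mulr_ge0 ?(ltW q0)//= mulr_ile1 ?(ltW q0)//.
by rewrite gerBl.
Qed.

Let qt2 : 0 <= q * t <= 2 * h.
Proof.
have q0 := step_q_gt0; have q1 := step_q_le1.
have t0 := step_t_ge0.
rewrite mulr_ge0 ?(ltW q0)//=; apply: le_trans step_t_le; rewrite ler_piMl//.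
Qed.

(** The five [step_coef] lemmas treat, in this order, the coefficients of [<nu, rho>], [<nu, y>],
    [<b, rho>], [<b, y>] and [<b, nu>] in identity [E5] of [energy_step]. *)
Lemma step_coef1 :
  `|4 * h * q ^+ 2 + 4 * h * q - 2 * e + 2 * q * (1 - t) * h| <= 10 * h + 2 * e.
Proof.
case/andP: qt1 => a b; have a1 : q * (1 - t) * h <= h by rewrite ler_piMl.
have a2 : 0 <= q * (1 - t) * h by rewrite mulr_ge0.
case/andP: hq2 => c d; have f := hq1.
by rewrite ler_norml; apply/andP; split; move: (a1) (a2) (c) (d) (e0) (f); lra.
Qed.

(** All contributions of order [h] have cancelled and each summand carries a factor [e = h - p].
    This is the effect of the cross term of the energy, and it is indispensable because nothing
    contracts [|y|^2]. *)
Lemma step_coef2 :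
  `| - (4 * h * q * e / (1 + 2 * h)) + 2 * e * (1 + p) + 2 * q * (1 - t) * e * (3 + 4 * h)|
   <= 22 * e.
Proof.
case/andP: qt1 => qta qtb; case/andP: hq2 => c d; have f := hq1.
have a1 : h * q * e / (1 + 2 * h) <= e.
  rewrite ler_pdivrMr// mulrC ler_wpM2l//; move: (f) (h0); lra.
have a2 : 0 <= h * q * e / (1 + 2 * h).
  by rewrite divr_ge0 ?(ltW ht)// (mulr_ge0 _ e0)// (mulr_ge0 h0)// ltW// step_q_gt0.
have a0 : 0 <= e * (3 + 4 * h) by rewrite mulr_ge0//; move: (h0); lra.
have a3 : q * (1 - t) * (e * (3 + 4 * h)) <= e * (3 + 4 * h) by rewrite ler_piMl.
have a4 : 0 <= q * (1 - t) * (e * (3 + 4 * h)) by rewrite mulr_ge0.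
have a5 : e * h <= e by rewrite ler_piMr.
have a6 : e * p <= e by rewrite ler_piMr// (le_trans ph).
have a7 : 0 <= e * p by rewrite mulr_ge0.
by rewrite ler_norml; apply/andP; split; move: (a1) (a2) (a3) (a4) (a5) (a6) (a7) (e0); lra.
Qed.

Lemma step_coef3 :
  `| - (4 * h * q ^+ 2) - 4 * h * q + 2 * q * t * h| <= 12 * h.
Proof.
case/andP: qt2 => a b; case/andP: hq2 => c d; have f := hq1.
have a1 : q * t * h <= 2 * h.
  apply: (@le_trans _ _ (2 * h * h)); first by rewrite ler_wpM2r.
  by rewrite ler_piMr// mulr_ge0.
have a2 : 0 <= q * t * h by rewrite mulr_ge0.
by rewrite ler_norml; apply/andP; split; move: (a1) (a2) (c) (d) (f) (h0); lra.
Qed.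

Lemma step_coef4 :
  `| - (4 * h * q ^+ 2 * (1 + 2 * p)) + 4 * h * q * (1 + p) + 2 * q * t * e * (3 + 4 * h)|
  <= 48 * h.
Proof.
case/andP: qt2 => a b; case/andP: hq2 => c d; have f := hq1.
have a0 : 0 <= e * (3 + 4 * h) by rewrite mulr_ge0//; move: (h0); lra.
have a1 : q * t * (e * (3 + 4 * h)) <= 2 * h * 7.
  apply: ler_pM => //.
  have a5 : e * h <= e by rewrite ler_piMr.
  move: (a5) (e1); lra.
have a2 : 0 <= q * t * (e * (3 + 4 * h)) by rewrite mulr_ge0.
have p1 : p <= 1 by exact: le_trans h1.
have a3 : h * q ^+ 2 * p <= h * q by rewrite (le_trans _ d)// ler_piMr.
have a4 : 0 <= h * q ^+ 2 * p by rewrite mulr_ge0.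
have a5 : h * q * p <= h by rewrite (le_trans _ f)// ler_piMr// (le_trans c).
have a6 : 0 <= h * q * p by rewrite mulr_ge0// (le_trans c).
by rewrite ler_norml; apply/andP; split; move: (a1) (a2) (a3) (a4) (a5) (a6) (c) (d) (f) (h0); lra.
Qed.

Lemma step_coef5 : `|800 * t * (1 - t)| <= 1600 * h.
Proof.
have t0 := step_t_ge0; have t1 := step_t_le1; have tl := step_t_le.
have a1 : 0 <= t * (1 - t) by rewrite mulr_ge0// subr_ge0.
have a2 : t * (1 - t) <= t by rewrite ler_piMr// gerBl.
by rewrite ler_norml; apply/andP; split; move: (a1) (a2) (tl); lra.
Qed.

End Coefs.

Section EnergyStep.
Context {R : realFieldType} {V : lmodType R} (ip : V -> V -> R).
Hypothesis ipC : forall u v, ip u v = ip v u.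
Hypothesis ipDl : forall u v w, ip (u + v) w = ip u w + ip v w.
Hypothesis ipZl : forall a u v, ip (a *: u) v = a * ip u v.
Hypothesis ip_ge0 : forall u, 0 <= ip u u.
Local Notation ipE := (ipE ipC ipDl ipZl).
Local Notation ip_young := (ip_young ipC ipDl ipZl ip_ge0).
Local Notation ip_youngN := (ip_youngN ipC ipDl ipZl ip_ge0).

Lemma ip_norm_le (s : R) u v : 0 < s -> 2 * `|ip u v| <= s * ip u u + s^-1 * ip v v.
Proof.
move=> s0; have h1 := ip_young u v s0; have h2 := ip_youngN u v s0.
rewrite -[X in X * _]ger0_norm// -normrM ler_norml h1 andbT; exact: h2.
Qed.

Lemma ip_le (c C s : R) u v : `|c| <= C -> 0 < s ->
  c * ip u v <= C * (s * ip u u + s^-1 * ip v v) / 2.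
Proof.
move=> cC s0; have := ip_norm_le u v s0.
move=> h; apply: (le_trans (ler_norm _)); rewrite normrM -mulrA.
by apply: ler_pM => //; clear -ipC ipDl ipZl ip_ge0 h; lra.
Qed.

(** Young with weight [C h / tau]: the second vector costs only [tau], and the first, which will be
    the bias, carries [h^2 / tau]. For [h = 0] that weight vanishes, but then [c = 0]. *)
Lemma ip_le_scaled (c C h tau : R) u v : 0 < C -> 0 <= h -> 0 < tau ->
  `|c| <= 2 * C * h ->
  c * ip u v <= C ^+ 2 * (h ^+ 2 / tau) * ip u u + tau * ip v v.
Proof.
move=> C0 h0 tau0 cC; have tv : 0 <= tau * ip v v by rewrite mulr_ge0// ltW.
have [hE|hn] := eqVneq h 0.
  move: cC; rewrite hE mulr0 normr_le0 => /eqP ->.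
  by rewrite expr0n /= !(mul0r, mulr0) add0r.
have hp : 0 < h by rewrite lt_neqAle eq_sym hn.
have := ip_le u v cC (divr_gt0 (mulr_gt0 C0 hp) tau0).
by congr (_ <= _); field; rewrite hn !gt_eqF.
Qed.

Lemma step_bound1 (h e : R) (rho y : V) :
  0 <= h -> h <= 1 -> 0 <= e -> e <= 1 ->
  let q := (1 + h) / (1 + 2 * h) in
  is_true (q ^+ 2 * ip (rho - (2 * e) *: y) (rho - (2 * e) *: y) <=
   (1 - 5 / 9 * h) * ip rho rho + 2 * e * ip rho rho + 6 * e * ip y y).
Proof.
move=> h0 h1 e0 e1 q.
have q0 : 0 < q by exact: step_q_gt0 (lexx h).
have q1 : q <= 1 by exact: step_q_le1 (lexx h).
have q2 : q ^+ 2 <= 1 - 5 / 9 * h by exact: step_q2_le (lexx h) _.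
have rr0 := ip_ge0 rho; have yy0 := ip_ge0 y.
have Y1 : - (1 * ip rho rho + 1^-1 * ip y y) <= 2 * ip rho y by exact: ip_youngN.
rewrite invr1 in Y1.
apply: (@le_trans _ _ (q ^+ 2 * ((1 + 2 * e) * ip rho rho + (2 * e + 4 * e ^+ 2) * ip y y))).
  rewrite ler_pM2l ?exprn_gt0// !ipE (ipC y rho).
  have : e * (- (1 * ip rho rho + 1 * ip y y)) <= e * (2 * ip rho y) by rewrite ler_wpM2l.
  clear -ipC ipDl ipZl ip_ge0; lra.
have e2 : e ^+ 2 <= e by rewrite expr2 ler_piMl.
have qq1 : q ^+ 2 <= 1 by rewrite expr_le1// ltW.
have a1 : q ^+ 2 * ip rho rho <= (1 - 5 / 9 * h) * ip rho rho by rewrite ler_wpM2r.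
have a2 : q ^+ 2 * (2 * e * ip rho rho) <= 2 * e * ip rho rho.
  by rewrite ler_piMl// !mulr_ge0.
have a3 : q ^+ 2 * ((2 * e + 4 * e ^+ 2) * ip y y) <= (2 * e + 4 * e ^+ 2) * ip y y.
  by rewrite ler_piMl// mulr_ge0// addr_ge0 ?mulr_ge0// sqr_ge0.
have a4 : e ^+ 2 * ip y y <= e * ip y y by rewrite ler_wpM2r.
clear -ipC ipDl ipZl ip_ge0 a1 a2 a3 a4; lra.
Qed.

(** Origin of the bound 9/10: Young with weight 1/9 leaves [10/9 |D|^2], and
    [8 h^2 * (10/9) <= 4 h / k] is the same as [2 h k <= 9/10]. Under this step-size condition the
    cocoercivity term absorbs [D] completely. *)
Lemma step_bound2 (h k : R) (D b nu : V) :
  0 <= h -> h <= 1 -> 0 < k -> 2 * h * k <= 9 / 10 ->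
  let q := (1 + h) / (1 + 2 * h) in
  is_true (8 * h ^+ 2 * q ^+ 2 * ip (D - (b - nu)) (D - (b - nu))
    - 4 * h * q ^+ 2 / k * ip D D
   <= 160 * h ^+ 2 * ip b b + 160 * h * ip nu nu).
Proof.
move=> h0 h1 k0 hk q.
have q0 : 0 < q by exact: step_q_gt0 (lexx h).
have q1 : q <= 1 by exact: step_q_le1 (lexx h).
have nn0 := ip_ge0 nu; have bb0 := ip_ge0 b; have DD0 := ip_ge0 D.
have i9 : (0 : R) < 9^-1 by rewrite invr_gt0.
have Y1 := ip_youngN D (b - nu) i9.
have Y2 : - (1 * ip b b + 1^-1 * ip nu nu) <= 2 * ip b nu by exact: ip_youngN.
rewrite invrK in Y1; rewrite invr1 in Y2.
have a1 : ip (D - (b - nu)) (D - (b - nu)) <= 10 / 9 * ip D D + 10 * ip (b - nu) (b - nu).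
  by move: (b - nu) Y1 => B Y1; rewrite !ipE (ipC B D); clear -ipC ipDl ipZl ip_ge0 Y1; lra.
have a2 : ip (b - nu) (b - nu) <= 2 * ip b b + 2 * ip nu nu.
  by rewrite !ipE (ipC nu b); clear -ipC ipDl ipZl ip_ge0 Y2; lra.
have a3 : 8 * h ^+ 2 * (10 / 9) <= 4 * h / k.
  by rewrite ler_pdivlMr//; have := ler_wpM2l h0 hk; clear -ipC ipDl ipZl ip_ge0; lra.
have hq : 0 <= h ^+ 2 * q ^+ 2 by rewrite mulr_ge0 ?sqr_ge0.
have a4 : h ^+ 2 * q ^+ 2 * ip (D - (b - nu)) (D - (b - nu)) <=
  h ^+ 2 * q ^+ 2 * (10 / 9 * ip D D + 20 * ip b b + 20 * ip nu nu).
  by rewrite ler_wpM2l//; clear -ipC ipDl ipZl ip_ge0 a1 a2; lra.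
have a5 : q ^+ 2 * ip D D * (8 * h ^+ 2 * (10 / 9)) <= q ^+ 2 * ip D D * (4 * h / k).
  by rewrite ler_wpM2l// mulr_ge0// sqr_ge0.
have a6 : h ^+ 2 * q ^+ 2 <= h ^+ 2.
  by rewrite ler_piMr ?sqr_ge0// expr_le1// ltW.
have a7 : h ^+ 2 <= h by rewrite expr2 ler_piMl.
have a8 : h ^+ 2 * q ^+ 2 * ip b b <= h ^+ 2 * ip b b by rewrite ler_wpM2r.
have a9 : h ^+ 2 * q ^+ 2 * ip nu nu <= h * ip nu nu.
  by rewrite ler_wpM2r// (le_trans a6).
have -> : 4 * h * q ^+ 2 / k * ip D D = q ^+ 2 * ip D D * (4 * h / k) by ring.
clear -ipC ipDl ipZl ip_ge0 a4 a5 a8 a9; lra.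
Qed.

(** Balance of the constants. The square of [y] collects [(6 + 5 + 11) (h - p)] and the energy
    controls half of that square, whence 44; likewise [tau] becomes [2 tau]. The square of [b]
    collects [36 + 576 + 800^2 + 1760], below [10^6], and that of [xi] collects [8 + 1600], below
    2000. *)
Lemma energy_step (h p d d' k q t tau : R) (u u' y y' nu nu' D b xi : V) :
  0 <= p -> p <= h -> h <= 1 -> 0 <= d -> 0 < k -> 2 * h * k <= 9 / 10 ->
  0 < tau -> tau <= 1 ->
  q = (1 + h) / (1 + 2 * h) -> t = 2 * h / (1 + 2 * h) ->
  y' = (1 + 2 * h)^-1 *: (y + (2 * h) *: (D + y + nu - b - xi)) ->
  nu' = (1 + 2 * h)^-1 *: (nu + (2 * h) *: (b + xi)) ->
  u' = (3 * h) *: y' + q *: (u - (4 * h) *: y) ->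
  d' = q * (d - 2 * t * ip D (u + 2 *: y) - 2 * t / k * ip D D) ->
  energy ip h d' u' y' nu' <=
    (1 + 44 * (h - p) + 2 * tau) * energy ip p d u y nu
    + 10 ^+ 6 * (h ^+ 2 / tau) * ip b b + 2000 * h ^+ 2 * ip xi xi
    + ip xi (step_noise h p u y nu D b).
Proof.
move=> p0 ph h1 d0 k0 hk tau0 tau1 qE tE y'E nu'E u'E d'E.
have h0 : 0 <= h by exact: le_trans ph.
rewrite d'E u'E nu'E y'E qE tE (energy_step_eq ipC ipDl ipZl p d u y nu D b xi h0 k0).
rewrite -!qE -!tE lerD2r.
have low : 2^-1 * ip (u + (1 - 2 * p) *: y) (u + (1 - 2 * p) *: y)
  + 2^-1 * ip y y + 320 * ip nu nu + d <= energy ip p d u y nu.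
  by apply: energy_lower => //; rewrite p0 (le_trans ph).
have htn : 1 + 2 * h != 0 by rewrite gt_eqF//; clear -ipC ipDl ipZl ip_ge0 h0; lra.
have q0 : 0 < q by rewrite qE; exact: (step_q_gt0 p0 ph).
have q1 : q <= 1 by rewrite qE; exact: (step_q_le1 p0 ph).
have t0 : 0 <= t by rewrite tE; exact: (step_t_ge0 p0 ph).
have t1 : t <= 1 by rewrite tE; exact: (step_t_le1 p0 ph).
have t2h : t <= 2 * h by rewrite tE; exact: (step_t_le p0 ph).
have tge : 2 * h <= 3 * t by rewrite tE; exact: (step_t_ge p0 ph).
have e0 : 0 <= h - p by rewrite subr_ge0.
have e1 : h - p <= 1 by clear -ipC ipDl ipZl ip_ge0 p0 h1; lra.
have C1 := step_coef1 p0 ph; have C2 := step_coef2 p0 ph h1.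
have C3 := step_coef3 p0 ph h1; have C4 := step_coef4 p0 ph h1.
have C5 := step_coef5 p0 ph; rewrite -?qE -?tE in C1 C2 C3 C4 C5.
set rho := u + (1 - 2 * p) *: y in low *.
have uE : u = rho - (1 - 2 * p) *: y by rewrite /rho addrK.
set W := energy ip p d u y nu in low *.
have WE : W = ip rho rho + (1 + p) ^+ 2 * ip y y + (1 + p) * d
   - 2 * (1 + p) * ip nu (u - (3 * p) *: y) + 400 * ip nu nu by [].
clearbody W rho.
have rr0 := ip_ge0 rho; have yy0 := ip_ge0 y; have nn0 := ip_ge0 nu.
have bb0 := ip_ge0 b; have xx0 := ip_ge0 xi.
have B1 := step_bound1 rho y h0 h1 e0 e1.
have B4 := step_bound2 D b nu h0 h1 k0 hk.
rewrite /= -!qE in B1 B4.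
(* All remaining terms with [nu] or [b], expanded in the products of [nu] and [b] with [rho] and
   [y]. The last summand on the left subtracts the cross term already present in [W], so that only
   its increment is estimated. *)
have E5 : - (4 * h * q ^+ 2 * ip (b - nu) (u + 2 *: y))
    - 2 * (1 + h) * ip nu (u - (3 * p) *: y) - 4 * h * q * ip (b - nu) (u - (3 * p) *: y)
    + 2 * q * ip ((1 - t) *: nu + t *: b) (h *: rho + ((h - p) * (3 + 4 * h)) *: y)
    + 400 * ip ((1 - t) *: nu + t *: b) ((1 - t) *: nu + t *: b)
    + 2 * (1 + p) * ip nu (u - (3 * p) *: y)
  = (4 * h * q ^+ 2 + 4 * h * q - 2 * (h - p) + 2 * q * (1 - t) * h) * ip nu rho
    + (- (4 * h * q * (h - p) / (1 + 2 * h)) + 2 * (h - p) * (1 + p)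
       + 2 * q * (1 - t) * (h - p) * (3 + 4 * h)) * ip nu y
    + (- (4 * h * q ^+ 2) - 4 * h * q + 2 * q * t * h) * ip b rho
    + (- (4 * h * q ^+ 2 * (1 + 2 * p)) + 4 * h * q * (1 + p)
       + 2 * q * t * (h - p) * (3 + 4 * h)) * ip b y
    + 400 * (1 - t) ^+ 2 * ip nu nu + 400 * t ^+ 2 * ip b b + 800 * t * (1 - t) * ip b nu.
  rewrite uE !ipE (ipC nu b) qE tE; clear -ipC ipDl ipZl ip_ge0 htn; field.
  exact: htn.
have B2 : (1 + h) ^+ 2 * ip y y <= (1 + p) ^+ 2 * ip y y + 5 * (h - p) * ip y y.
  rewrite -mulrDl ler_wpM2r//.
  have a1 : 0 <= (h - p) * (1 - h) by rewrite mulr_ge0// subr_ge0.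
  have a2 : 0 <= (h - p) * (1 - p) by rewrite mulr_ge0// subr_ge0 (le_trans ph).
  by clear -ipC ipDl ipZl ip_ge0 a1 a2 e0; lra.
have B3 : (1 + h) * q * d <= (1 + p) * d + (h - p) * d.
  rewrite -mulrDl ler_wpM2r// (le_trans (y := 1 + h))//; last by clear -ipC ipDl ipZl ip_ge0; lra.
  by rewrite ler_piMr//; clear -ipC ipDl ipZl ip_ge0 h0; lra.
set c1 := (X in X * ip nu rho) in E5; set c2 := (X in X * ip nu y) in E5.
set c3 := (X in X * ip b rho) in E5; set c4 := (X in X * ip b y) in E5.
rewrite -/c1 in C1; rewrite -/c2 in C2; rewrite -/c3 in C3; rewrite -/c4 in C4.
clearbody c1 c2 c3 c4.
(* The weight 9 makes the part [10 h] of the coefficient spend exactly the reserve [5/9 h] of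
   [step_q2_le]; the part [2 (h - p)] may use weight 1. *)
have P1 : c1 * ip nu rho <= 45 * h * ip nu nu + 5 / 9 * h * ip rho rho
    + (h - p) * (ip nu nu + ip rho rho).
  have Y1 : 2 * `|ip nu rho| <= 9 * ip nu nu + 9^-1 * ip rho rho by exact: ip_norm_le.
  have Y2 : 2 * `|ip nu rho| <= 1 * ip nu nu + 1^-1 * ip rho rho by exact: ip_norm_le.
  rewrite invr1 in Y2.
  apply: (le_trans (ler_norm _)); rewrite normrM.
  have a1 : `|c1| * `|ip nu rho| <= (10 * h + 2 * (h - p)) * `|ip nu rho| by rewrite ler_wpM2r.
  have a2 := ler_wpM2l h0 Y1; have a3 := ler_wpM2l e0 Y2.
  by clear -ipC ipDl ipZl ip_ge0 a1 a2 a3; lra.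
have P2 : c2 * ip nu y <= 11 * (h - p) * (ip nu nu + ip y y).
  by have := ip_le nu y C2 (ltr01 : 0 < 1); rewrite invr1; clear -ipC ipDl ipZl ip_ge0; lra.
have P3 : c3 * ip b rho <= 36 * (h ^+ 2 / tau) * ip b b + tau * ip rho rho.
  have -> : 36 = 6 ^+ 2 :> R by ring.
  apply: ip_le_scaled; [by rewrite ltr0n|exact: h0|exact: tau0|apply: (le_trans C3)].
  by clear -ipC ipDl ipZl ip_ge0; lra.
have P4 : c4 * ip b y <= 576 * (h ^+ 2 / tau) * ip b b + tau * ip y y.
  have -> : 576 = 24 ^+ 2 :> R by ring.
  apply: ip_le_scaled; [by rewrite ltr0n|exact: h0|exact: tau0|apply: (le_trans C4)].
  by clear -ipC ipDl ipZl ip_ge0; lra.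
have P5 : 800 * t * (1 - t) * ip b nu <= 800 ^+ 2 * (h ^+ 2 / tau) * ip b b + tau * ip nu nu.
  apply: ip_le_scaled; [by rewrite ltr0n|exact: h0|exact: tau0|apply: (le_trans C5)].
  by clear -ipC ipDl ipZl ip_ge0; lra.
(* Averaging shrinks the old error: [400 (1 - t)^2 <= 400 - 400 t] and [3 t >= 2 h]. The gain
   [266 h] covers [45 h] from [P1] and [160 h] from [B4]; this fixes the weight 400. *)
have P6 : 400 * (1 - t) ^+ 2 * ip nu nu <= 400 * ip nu nu - 266 * h * ip nu nu.
  have : 400 * (1 - t) ^+ 2 <= 400 - 266 * h.
    have a1 : 0 <= t * (1 - t) by rewrite mulr_ge0// subr_ge0.
    by clear -ipC ipDl ipZl ip_ge0 a1 tge h0; lra.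
  by move=> /(ler_wpM2r nn0); clear -ipC ipDl ipZl ip_ge0; lra.
have tt2 : t ^+ 2 <= 4 * h ^+ 2.
  have a1 : 0 <= (2 * h - t) * (2 * h + t) by rewrite mulr_ge0 ?subr_ge0// addr_ge0// mulr_ge0.
  by clear -ipC ipDl ipZl ip_ge0 a1; lra.
have htau : h ^+ 2 <= h ^+ 2 / tau by rewrite ler_pdivlMr// ler_piMr// sqr_ge0.
have P7 : 400 * t ^+ 2 * ip b b + 160 * h ^+ 2 * ip b b <= 1760 * (h ^+ 2 / tau) * ip b b.
  by have := ler_wpM2r bb0 tt2; have := ler_wpM2r bb0 htau; clear -ipC ipDl ipZl ip_ge0; lra.
have P8 : 8 * h ^+ 2 * q ^+ 2 * ip xi xi + 400 * t ^+ 2 * ip xi xi <= 2000 * h ^+ 2 * ip xi xi.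
  have a1 : h ^+ 2 * q ^+ 2 <= h ^+ 2.
    by rewrite ler_piMr ?sqr_ge0// expr_le1// ltW.
  have := ler_wpM2r xx0 tt2; have := ler_wpM2r xx0 a1.
  have : 0 <= h ^+ 2 * ip xi xi by rewrite mulr_ge0 ?sqr_ge0.
  by clear -ipC ipDl ipZl ip_ge0; lra.
have F1 := ler_wpM2l e0 low; have F2 := ler_wpM2l (ltW tau0) low.
have n1 : 0 <= h * ip nu nu by rewrite mulr_ge0.
have n2 : 0 <= (h - p) * ip nu nu by rewrite mulr_ge0.
have n3 : 0 <= tau * ip nu nu by rewrite mulr_ge0// ltW.
have n4 : 0 <= (h - p) * d by rewrite mulr_ge0.
have n5 : 0 <= tau * d by rewrite mulr_ge0// ltW.
have n7 : 0 <= (h - p) * ip rho rho by rewrite mulr_ge0.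
have n8 : 0 <= (h - p) * ip y y by rewrite mulr_ge0.
have n6 : 0 <= h ^+ 2 / tau * ip b b by rewrite mulr_ge0 ?divr_ge0 ?sqr_ge0 ?(ltW tau0).
have n9 : (800 ^+ 2 + 3000) * (h ^+ 2 / tau * ip b b) <= 10 ^+ 6 * (h ^+ 2 / tau * ip b b).
  apply: ler_wpM2r => //; clear -ipC ipDl ipZl ip_ge0; lra.
rewrite -[10 ^+ 6 * _ * ip b b]mulrA.
move: n9; set c := 10 ^+ 6 * _ => n9; clearbody c.
move: E5; set Z1 := ip (b - nu) (u + 2 *: y); set Z2 := ip nu (u - _).
set Z3 := ip (b - nu) (u - _); set Z4 := ip (_ + _) (h *: rho + _).
set Z5 := ip ((1 - t) *: nu + _) _; move=> E5.
rewrite -/Z2 in WE; clearbody Z1 Z2 Z3 Z4 Z5.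
move: B1 B4; set Z6 := ip (rho - _) _; set Z7 := ip (D - _) _ => B1 B4.
clearbody Z6 Z7.
clear -ipC ipDl ipZl ip_ge0 WE B1 B2 B3 B4 E5 P1 P2 P3 P4 P5 P6 P7 P8 F1 F2 n1 n2 n3 n4 n5 n6 n7 n8 n9.
set X := ip nu rho in E5 P1; set X2 := ip nu y in E5 P2.
lra.
Qed.
End EnergyStep.

(** * Energy along a path *)

(** The new value enters with weight [2 h_j / (1 + 2 h_j)]. In the application [h_0 = 0], so the
    value at index 0 never counts and the average at time 1 is still [v0]. *)
Fixpoint running_avg {R : realFieldType} {V : lmodType R} (h : nat -> R)
    (v0 : V) (v : nat -> V) k : V :=
  if k is j.+1 then (1 + 2 * h j)^-1 *: (running_avg h v0 v j + (2 * h j) *: v j)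
  else v0.
Arguments running_avg : simpl never.

Lemma running_avg0 {R : realFieldType} {V : lmodType R} (h : nat -> R)
    (v0 : V) (v : nat -> V) : running_avg h v0 v 0 = v0.
Proof. by []. Qed.

Lemma running_avgS {R : realFieldType} {V : lmodType R} (h : nat -> R)
    (v0 : V) (v : nat -> V) k :
  running_avg h v0 v k.+1 =
  (1 + 2 * h k)^-1 *: (running_avg h v0 v k + (2 * h k) *: v k).
Proof. by []. Qed.

Section Pathwise.
Context {R : realFieldType} {V : lmodType R} (ip : V -> V -> R).
Hypothesis ipC : forall u v, ip u v = ip v u.
Hypothesis ipDl : forall u v w, ip (u + v) w = ip u w + ip v w.
Hypothesis ipZl : forall a u v, ip (a *: u) v = a * ip u v.
Hypothesis ip_ge0 : forall u, 0 <= ip u u.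
Hypothesis ip_eq0 : forall u, ip u u = 0 -> u = 0.
Local Notation ipE := (ipE ipC ipDl ipZl).

(** Turns an identity between vectors into one between scalars, which [field] decides once the inner
    products are expanded. *)
Lemma ip_inj u v : ip (u - v) (u - v) = 0 -> u = v.
Proof. by move=> /ip_eq0 /eqP; rewrite subr_eq0 => /eqP. Qed.

(** For [g = G x - G y] and [z = x - y] with [G = id - T], this is half of
    [|x - y|^2 - |T x - T y|^2]; its nonnegativity is nonexpansiveness of [T]. *)
Definition coco_gap (g z : V) : R := ip g z - ip g g / 2.

Variables (G : V -> V) (p : V) (z : nat -> V) (h : nat -> R).
Hypothesis Gp : G p = 0.
Hypothesis G_coco : forall x y, 0 <= coco_gap (G x - G y) (x - y).
Hypothesis h0 : h 0%N = 0.
Hypothesis h_ge0 : forall k, 0 <= h k.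

Let zb := running_avg h p z.
Let gb := running_avg h 0 (fun k => G (z k)).

Let gbS k : gb k.+1 = (1 + 2 * h k)^-1 *: (gb k + (2 * h k) *: G (z k)).
Proof. by []. Qed.
Let zbS k : zb k.+1 = (1 + 2 * h k)^-1 *: (zb k + (2 * h k) *: z k).
Proof. by []. Qed.

(** The one-pass update of a weighted covariance: a point added with weight [t = 2h / (1 + 2h)]
    contributes [t (1 - t)] times its gap to the previous mean. The pair [(p, G p) = (p, 0)] is the
    initial point of the family. *)
Fixpoint dispersion k : R :=
  if k is j.+1 then
    (1 + 2 * h j)^-1 * (dispersion j
      + 2 * h j / (1 + 2 * h j) * coco_gap (G (z j) - gb j) (z j - zb j))
  else 0.

Lemma dispersionS k : dispersion k.+1 =
  (1 + 2 * h k)^-1 * (dispersion k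
      + 2 * h k / (1 + 2 * h k) * coco_gap (G (z k) - gb k) (z k - zb k)).
Proof. by []. Qed.
Arguments dispersion : simpl never.

Let hp k : 0 < 1 + 2 * h k. Proof. by rewrite ltr_wpDr// mulr_ge0. Qed.
Let hn k : 1 + 2 * h k != 0. Proof. by rewrite gt_eqF. Qed.

(** Parallel-axis identity for the quadratic form [coco_gap]: dispersion plus gap to the mean is the
    mean gap to the individual points, hence is averaged step by step. *)
Lemma dispersion_mix k v w :
  dispersion k.+1 + coco_gap (w - gb k.+1) (v - zb k.+1) =
  (1 + 2 * h k)^-1 * (dispersion k + coco_gap (w - gb k) (v - zb k))
  + 2 * h k / (1 + 2 * h k) * coco_gap (w - G (z k)) (v - z k).
Proof.
rewrite dispersionS gbS zbS /coco_gap.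
move: (gb k) (zb k) (dispersion k) (z k) (G (z k)) (h k) (hn k) => g0 z0 E zk gk hk hkn.
rewrite !ipE (ipC g0 w) (ipC gk w) (ipC g0 gk).
by field.
Qed.

(** By the parallel-axis identity this is a weighted mean of the gaps between [v] and the points [p]
    and [z j], each nonnegative by cocoercivity. At [v = z k] it gives both [dispersion_ge0] and the
    bound for the last residual. *)
Lemma dispersion_gap_ge0 k v : 0 <= dispersion k + coco_gap (G v - gb k) (v - zb k).
Proof.
elim: k => [|k IH]; first by rewrite /gb /zb !running_avg0 add0r -Gp G_coco.
rewrite dispersion_mix addr_ge0// mulr_ge0//.
- by rewrite invr_ge0 ltW.
- by rewrite divr_ge0 ?mulr_ge0// ltW.
Qed.

Lemma dispersion_ge0 k : 0 <= dispersion k.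
Proof.
elim: k => [//|k IH]; rewrite dispersionS.
have hk := h_ge0 k.
have -> : dispersion k + 2 * h k / (1 + 2 * h k) * coco_gap (G (z k) - gb k) (z k - zb k)
  = (1 + 2 * h k)^-1 * (dispersion k + 2 * h k *
     (dispersion k + coco_gap (G (z k) - gb k) (z k - zb k))).
  by field.
by rewrite !mulr_ge0 ?addr_ge0 ?mulr_ge0 ?invr_ge0 ?(ltW (hp k))// dispersion_gap_ge0.
Qed.

Variables (x b xi : nat -> V) (om : nat -> R) (c : R).
Hypothesis om_gt0 : forall k, 0 < om k.
Hypothesis c_gt0 : 0 < c.
Hypothesis omE : forall k, om k = (1 + h k.+1) * om k.+1.

Let W := running_avg h 0 (fun k => G (z k) - b k - xi k).

Let WS k : W k.+1 = (1 + 2 * h k)^-1 *: (W k + (2 * h k) *: (G (z k) - b k - xi k)).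
Proof. by []. Qed.

(* Scaled so that [path_D + path_y + path_nu = (c / 2) G z_k]; [path_nu] carries the averaged
   bias and noise. *)
Definition path_u k : V := (om k.-1)^-1 *: (zb k - x k).
Definition path_y k : V := (c / 2) *: W k.
Definition path_nu k : V := (c / 2) *: (gb k - W k).
Definition path_d k : R := c * dispersion k / om k.-1.
Definition path_D k : V := (c / 2) *: (G (z k) - gb k).
Definition path_energy k : R :=
  energy ip (h k.-1) (path_d k) (path_u k) (path_y k) (path_nu k).
Definition path_noise k : V :=
  step_noise (h k) (h k.-1) (path_u k) (path_y k) (path_nu k) (path_D k) ((c / 2) *: b k).

Lemma path_d_ge0 k : 0 <= path_d k.
Proof. by rewrite /path_d divr_ge0 ?mulr_ge0 ?dispersion_ge0 ?ltW. Qed.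

Lemma path_energy_ge k : (h k.-1 <= 1) ->
  2^-1 * ip (path_u k + (1 - 2 * h k.-1) *: path_y k) (path_u k + (1 - 2 * h k.-1) *: path_y k)
  + 2^-1 * ip (path_y k) (path_y k) + 320 * ip (path_nu k) (path_nu k) + path_d k
  <= path_energy k.
Proof.
move=> h1; apply: energy_lower => //; first by rewrite h_ge0.
exact: path_d_ge0.
Qed.

Lemma path_energyS k (tau : R) : (0 < k)%N ->
  x k.+1 = x k - (3 * c / 2 * (om k.-1 - om k)) *: W k.+1 ->
  z k = x k - (c * om k.-1) *: W k ->
  h k.-1 <= h k -> h k <= 1 -> 2 * h k * (c * om k.-1) <= 9 / 10 ->
  0 < tau -> tau <= 1 ->
  path_energy k.+1 <= (1 + 44 * (h k - h k.-1) + 2 * tau) * path_energy k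
    + 10 ^+ 6 * (h k ^+ 2 / tau) * ((c / 2) ^+ 2 * ip (b k) (b k))
    + 2000 * h k ^+ 2 * ((c / 2) ^+ 2 * ip (xi k) (xi k))
    + ip (xi k) ((c / 2) *: path_noise k).
Proof.
case: k => // k _ xE zE hmono hk1 hsmall t0 t1.
rewrite /= in xE zE hmono hsmall *.
have om1 := om_gt0 k.+1; have omk := om_gt0 k.
have omkE := omE k.
have d0 := path_d_ge0 k.+1.
set h1 := h k.+1; have h1n : 1 + 2 * h1 != 0 by exact: hn.
have h1p : 1 + h1 != 0 by rewrite gt_eqF// ltr_wpDr// h_ge0.
have omn : om k.+1 != 0 by rewrite gt_eqF.
have omn' : om k != 0 by rewrite gt_eqF.
have cn : c != 0 by rewrite gt_eqF.
have gE : path_D k.+1 + path_y k.+1 + path_nu k.+1 = (c / 2) *: G (z k.+1).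
  by rewrite /path_D /path_y /path_nu -!scalerDr; congr (_ *: _); rewrite -addrA subrKC subrK.
have yE : path_y k.+2 = (1 + 2 * h1)^-1 *: (path_y k.+1 + (2 * h1) *:
   (path_D k.+1 + path_y k.+1 + path_nu k.+1 - (c / 2) *: b k.+1 - (c / 2) *: xi k.+1)).
  rewrite gE /path_y WS.
  apply: ip_inj; rewrite -/h1.
  move: (W k.+1) (z k.+1) => B Z; move: (G Z) (b _) (xi _) => g b1 x1.
  by rewrite !ipE; field.
have nuE : path_nu k.+2 = (1 + 2 * h1)^-1 *: (path_nu k.+1 + (2 * h1) *:
   ((c / 2) *: b k.+1 + (c / 2) *: xi k.+1)).
  rewrite /path_nu WS gbS -scalerDr.
  apply: ip_inj; rewrite -/h1.
  move: (gb k.+1) (W k.+1) (z k.+1) => A B Z; move: (G Z) (b _) (xi _) => g b1 x1.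
  by rewrite !ipE; field.
have uE : path_u k.+2 = (3 * h1) *: path_y k.+2
   + ((1 + h1) / (1 + 2 * h1)) *: (path_u k.+1 - (4 * h1) *: path_y k.+1).
  rewrite /path_u /= xE /path_y zbS zE -/h1.
  apply: ip_inj; rewrite omkE -/h1.
  move: (zb k.+1) (x k.+1) (W k.+1) (W k.+2) => A B C D.
  by rewrite !ipE; field; rewrite omn h1n h1p.
have dE : path_d k.+2 = (1 + h1) / (1 + 2 * h1) * (path_d k.+1
   - 2 * (2 * h1 / (1 + 2 * h1)) * ip (path_D k.+1) (path_u k.+1 + 2 *: path_y k.+1)
   - 2 * (2 * h1 / (1 + 2 * h1)) / (c * om k) * ip (path_D k.+1) (path_D k.+1)).
  (* Here [z - zb] equals [- om k] times [path_u + 2 path_y], and passing from [om k] to [om k.+1]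
     in the denominator supplies the numerator [1 + h1] of [q]. *)
  rewrite /path_d /= dispersionS -/h1 /coco_gap /path_u /path_y /path_D /=.
  move: (G _ - _) => g; rewrite zE omkE -/h1.
  move: (dispersion k.+1) (zb k.+1) (x k.+1) (W k.+1) => E B C D.
  by rewrite !ipE; field; rewrite omn h1n h1p cn.
have := energy_step ipC ipDl ipZl ip_ge0 (h_ge0 k) hmono hk1 d0
  (mulr_gt0 c_gt0 omk) hsmall t0 t1 erefl erefl yE nuE uE dE.
rewrite /path_energy /path_noise /= -/h1.
by rewrite !(ipZl _ (b _)) !(ipZl _ (xi _)) !(ipZr ipC ipZl) !mulrA.
Qed.
End Pathwise.

Section Pathwise.
Context {R : realFieldType} {V : lmodType R} (ip : V -> V -> R).
Hypothesis ipC : forall u v, ip u v = ip v u.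
Hypothesis ipDl : forall u v w, ip (u + v) w = ip u w + ip v w.
Hypothesis ipZl : forall a u v, ip (a *: u) v = a * ip u v.
Hypothesis ip_ge0 : forall u, 0 <= ip u u.
Hypothesis ip_eq0 : forall u, ip u u = 0 -> u = 0.
Local Notation ipE := (ipE ipC ipDl ipZl).

Lemma ip_sqD u v : ip (u + v) (u + v) <= 2 * ip u u + 2 * ip v v.
Proof.
have := ip_young ipC ipDl ipZl ip_ge0 u v ltr01.
rewrite !ipE (ipC v u) invr1; lra.
Qed.

Variables (G : V -> V) (p : V) (z : nat -> V) (h : nat -> R).
Hypothesis Gp : G p = 0.
Hypothesis G_coco : forall x y, 0 <= coco_gap ip (G x - G y) (x - y).
Hypothesis h0 : h 0%N = 0.
Hypothesis h_ge0 : forall k, 0 <= h k.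
Variables (x b xi : nat -> V) (om : nat -> R) (c : R).
Hypothesis om_gt0 : forall k, 0 < om k.
Hypothesis c_gt0 : 0 < c.
Let W := running_avg h 0 (fun k => G (z k) - b k - xi k).
Let gb := running_avg h 0 (fun k => G (z k)).
Let zb := running_avg h p z.
Local Notation path_energy := (path_energy ip G p z h x b xi om c).

Lemma coco_lip v w : ip (G v - G w) (G v - G w) <= 4 * ip (v - w) (v - w).
Proof.
have := G_coco v w; rewrite /coco_gap.
have := ip_young ipC ipDl ipZl ip_ge0 (G v - G w) (v - w) (ltac:(lra) : 0 < 2^-1).
rewrite invrK; lra.
Qed.

(** The residual at [z k] is compared with the averaged one by treating [z k] as an additional point
    of the family. The points [x k], [y k] and [z k] all differ from [z k] by a multiple of [W k],
    which the 2-Lipschitz map [G] tolerates. *)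
Lemma residual_le k v s : h k.-1 <= 1 -> c * om k.-1 <= 1 ->
  z k = x k - (c * om k.-1) *: W k ->
  `|s| <= 2 -> v - z k = (s * (c * om k.-1)) *: W k ->
  ip (G v) (G v) <= 1000 / c ^+ 2 * path_energy k.
Proof.
move=> hk1 kap zE s2 vE.
have low := path_energy_ge ipC ipDl ipZl ip_ge0 z Gp G_coco h_ge0 x b xi om_gt0 c_gt0 hk1.
have d0 := path_d_ge0 ipC ipDl ipZl z Gp G_coco h_ge0 om_gt0 c_gt0 k.
have Q0 := dispersion_gap_ge0 ipC ipDl ipZl z Gp G_coco h_ge0 k (z k).
rewrite -/gb -/zb in Q0.
have omk := om_gt0 k.-1; have omn : om k.-1 != 0 by rewrite gt_eqF.
have cn : c != 0 by rewrite gt_eqF.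
set E := path_energy k in low *.
set y := path_y _ _ _ _ _ _ _ in low; set nu := path_nu _ _ _ _ _ _ _ in low.
set u := path_u _ _ _ _ _ _ in low; set d := path_d _ _ _ _ _ _ _ _ in low d0.
set rho := u + _ in low.
have c2 : 2 / c * (c / 2) = 1 by field; rewrite cn.
have yE : W k = (2 / c) *: y.
  by rewrite /y /path_y scalerA c2 scale1r.
have gbE : gb k = (2 / c) *: (y + nu).
  rewrite /y /nu /path_y /path_nu -scalerDr -/W -/gb subrKC.
  by rewrite scalerA c2 scale1r.
have zbE : z k - zb k = - (om k.-1 *: (rho + (1 + 2 * h k.-1) *: y)).
  have -> : rho + (1 + 2 * h k.-1) *: y = u + 2 *: y.
    by rewrite /rho -addrA -scalerDl; congr (_ + _ *: _); ring.
  rewrite /u /path_u -/zb zE yE; apply: (ip_inj ip_eq0).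
  move: (x k) (zb k) (y) => x1 z1 y1.
  by rewrite !ipE; field; rewrite omn cn.
have dE : dispersion ip G p z h k = d * om k.-1 / c.
  by rewrite /d /path_d; field; rewrite ?omn ?cn.
clearbody E y nu rho d u.
have rr0 := ip_ge0 rho; have yy0 := ip_ge0 y; have nn0 := ip_ge0 nu.
pose I := (c ^+ 2)^-1; have I0 : 0 < I by rewrite invr_gt0 exprn_gt0.
have H1 : ip (G (z k) - gb k) (G (z k) - gb k) <= 4 * dispersion ip G p z h k
    + 4 * ip (z k - zb k) (z k - zb k).
  move: Q0; rewrite /coco_gap.
  have := ip_young ipC ipDl ipZl ip_ge0 (G (z k) - gb k) (z k - zb k) (ltac:(lra) : 0 < 2^-1).
  rewrite invrK; lra.
have kap0 : 0 < c * om k.-1 by rewrite mulr_gt0.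
have H2 : dispersion ip G p z h k <= I * E.
  rewrite dE (_ : _ / c = I * ((c * om k.-1) * d)); last by rewrite /I; field.
  apply: ler_pM => //; [exact: ltW|by apply: mulr_ge0 => //; exact: ltW|].
  by apply: (@le_trans _ _ d); [rewrite ler_piMl|lra].
have kap2 : (c * om k.-1) ^+ 2 <= 1 by rewrite expr_le1// ltW.
have H3 : ip (z k - zb k) (z k - zb k) <= I * (40 * E).
  rewrite zbE (ipNl ipZl) (ipNr ipC ipZl) opprK ipZl (ipZr ipC ipZl).
  set v1 := rho + _.
  rewrite (_ : om k.-1 * _ = I * ((c * om k.-1) ^+ 2 * ip v1 v1)); last by rewrite /I; field.
  apply: ler_wpM2l; first exact: ltW.
  apply: (@le_trans _ _ (ip v1 v1)); first by rewrite ler_piMl.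
  apply: (le_trans (ip_sqD _ _)); rewrite ipZl (ipZr ipC ipZl) mulrA -expr2.
  have hh : (1 + 2 * h k.-1) ^+ 2 * ip y y <= 9 * ip y y.
    apply: ler_wpM2r => //; have := h_ge0 k.-1; nra.
  lra.
have H4 : ip (gb k) (gb k) <= I * (20 * E).
  rewrite gbE ipZl (ipZr ipC ipZl) (_ : 2 / c * (2 / c * _) = I * (4 * ip (y + nu) (y + nu))); last by rewrite /I; field.
  apply: ler_wpM2l; first exact: ltW.
  have := ip_sqD y nu; lra.
have H5 : ip (W k) (W k) <= I * (8 * E).
  rewrite yE ipZl (ipZr ipC ipZl) (_ : 2 / c * (2 / c * _) = I * (4 * ip y y)); last by rewrite /I; field.
  apply: ler_wpM2l; first exact: ltW.
  lra.
(* In units of [I * E]: [H1] gives [4 + 160 = 164], then the residual at [z k] costs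
   [2 * 164 + 2 * 20 = 368], and the one at [v] costs [2 * (4 * 4 * 8) + 2 * 368 = 992], rounded to
   1000. *)
have H6 := ip_sqD (G (z k) - gb k) (gb k); rewrite subrK in H6.
have H7 := ip_sqD (G v - G (z k)) (G (z k)); rewrite subrK in H7.
have H8 := coco_lip v (z k).
have H9 : ip (v - z k) (v - z k) <= 4 * ip (W k) (W k).
  rewrite vE ipZl (ipZr ipC ipZl) mulrA -expr2 ler_wpM2r// -real_normK ?num_real//.
  rewrite (_ : 4 = 2 ^+ 2); last by ring.
  rewrite lerXn2r ?nnegrE// normrM (gtr0_norm kap0) -[2]mulr1.
  by apply: ler_pM => //; exact: ltW.
rewrite -[1000 / _]/(1000 * I).
have IE0 : 0 <= I * E.
  by rewrite mulr_ge0 ?(ltW I0)//; lra.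
clear - H1 H2 H3 H4 H5 H6 H7 H8 H9 IE0 ipC ipDl ipZl ip_ge0 ip_eq0 Gp G_coco h0 h_ge0 om_gt0 c_gt0.
lra.
Qed.
End Pathwise.

(** * The softplus schedule *)

Section LogFacts.
Context {R : realType}.
Implicit Types x y Q : R.

Lemma nincr_on_pos (f df : R -> R) :
  (forall x, 0 < x -> is_derive x 1 f (df x)) -> (forall x, 0 < x -> df x <= 0) ->
  forall x y, 0 < x -> x <= y -> f y <= f x.
Proof.
move=> fdf df0 x y x0 xy.
apply: (@ler0_derive1_le_cc R f x y); rewrite ?in_itv/= ?lexx ?xy//.
- move=> t; rewrite in_itv/= => /andP[xt _].
  by have [] := fdf t (lt_trans x0 xt).
- move=> t; rewrite in_itv/= => /andP[xt _].
  by rewrite derive1E; have [_ ->] := fdf t (lt_trans x0 xt); exact/df0/(lt_trans x0 xt).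
- apply: derivable_within_continuous => t; rewrite in_itv/= => /andP[xt _].
  by have [] := fdf t (lt_le_trans x0 xt).
Qed.

Lemma ln_scale_le (a lam : R) : 0 < a -> 0 <= lam <= 1 ->
  lam * ln a <= ln (1 + lam * (a - 1)).
Proof.
move=> a0 /andP[l0 l1].
have := concave_ln (Itv01 l0 l1) a0 (ltr01).
rewrite !convRE /= ln1 mulr0 addr0 mulr1; congr (_ <= ln _).
by rewrite /unstable.onem; ring.
Qed.

Lemma ln1D_ratio_le x y : 0 < x -> x <= y ->
  (1 + x) * ln (1 + x) / x <= (1 + y) * ln (1 + y) / y.
Proof.
move=> x0 xy; have y0 : 0 < y by exact: lt_le_trans xy.
have x1 : 0 < 1 + x by rewrite addr_gt0.
have y1 : 0 < 1 + y by rewrite addr_gt0.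
(* Chosen so that [(1 + x)^-1] is the convex combination of [(1 + y)^-1] and [1] with weight [lam];
   concavity of [ln] then gives the claim. *)
pose lam := x / (1 + x) / (y / (1 + y)).
have l1 : 0 <= lam <= 1.
  rewrite /lam divr_ge0 ?divr_ge0 ?(ltW x0) ?(ltW y0) ?(ltW x1) ?(ltW y1)//=.
  rewrite ler_pdivrMr ?divr_gt0// mul1r ler_pdivrMr// mulrAC ler_pdivlMr//.
  nra.
have iy0 : 0 < (1 + y)^-1 by rewrite invr_gt0.
have := ln_scale_le iy0 l1.
have -> : 1 + lam * ((1 + y)^-1 - 1) = (1 + x)^-1.
  by rewrite /lam; field; rewrite !gt_eqF.
rewrite !lnV ?posrE// => h.
have {}h : ln (1 + x) <= lam * ln (1 + y) by lra.
rewrite ler_pdivrMr// (le_trans (ler_wpM2l (ltW x1) h))// /lam le_eqVlt; apply/orP; left.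
by apply/eqP; field; rewrite !gt_eqF.
Qed.

(** With [psi t = (1 + t) ln (1 + t) / t], the derivative of the quotient has the sign of
    [psi t - psi (Q t)], and [psi] is nondecreasing. *)
Lemma ln1D_quot_le Q x y : 1 <= Q -> 0 < x -> x <= y ->
  ln (1 + Q * y) / ln (1 + y) <= ln (1 + Q * x) / ln (1 + x).
Proof.
move=> Q1 x0 xy; have Q0 : 0 < Q by exact: lt_le_trans Q1.
pose f t := ln (1 + Q * t) / ln (1 + t) : R.
pose df t := ln (1 + Q * t) * (- (ln (1 + t)) ^- 2 * (1 + t)^-1)
   + (ln (1 + t))^-1 * ((1 + Q * t)^-1 * Q) : R.
apply: (@nincr_on_pos f df) => // t t0.
  have t1 : 0 < 1 + t by rewrite addr_gt0.
  have Qt1 : 0 < 1 + Q * t by rewrite addr_gt0// mulr_gt0.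
  have lt1 : ln (1 + t) != 0 by rewrite gt_eqF// ln_gt0// ltrDl.
  have d1 : is_derive t 1 (fun t : R => 1 + Q * t) Q.
    have := is_deriveD (is_derive_cst (1 : R) t 1) (is_deriveZ Q (is_derive_id t (1 : R))).
    by rewrite add0r /GRing.scale/= mulr1.
  have d2 : is_derive t 1 (fun t : R => 1 + t) 1.
    have := is_deriveD (is_derive_cst (1 : R) t 1) (is_derive_id t (1 : R)).
    by rewrite add0r.
  have d3 : is_derive t 1 (fun t : R => ln (1 + Q * t)) ((1 + Q * t)^-1 * Q).
    exact: (@is_derive1_comp R (@ln R) (fun t : R => 1 + Q * t) t _ _ (is_derive1_ln Qt1) d1).
  have d4 : is_derive t 1 (fun t : R => ln (1 + t)) ((1 + t)^-1 * 1).
    exact: (@is_derive1_comp R (@ln R) (fun t : R => 1 + t) t _ _ (is_derive1_ln t1) d2).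
  have d5 := @is_deriveV R (fun t : R => ln (1 + t)) t _ 1 lt1 d4.
  have := is_deriveM d3 d5.
  by rewrite /GRing.scale/= mulr1.
have t1 : 0 < 1 + t by rewrite addr_gt0.
have Qt0 : 0 < Q * t by rewrite mulr_gt0.
have Qt1 : 0 < 1 + Q * t by rewrite addr_gt0.
have lt1 : 0 < ln (1 + t) by rewrite ln_gt0// ltrDl.
have tQt : t <= Q * t by rewrite ler_peMl// ltW.
have := ln1D_ratio_le t0 tQt.
rewrite ler_pdivrMr// mulrAC ler_pdivlMr// => h.
have -> : df t = ((1 + t) * ln (1 + t) * (Q * t) - (1 + Q * t) * ln (1 + Q * t) * t)
   / (ln (1 + t) ^+ 2 * (1 + t) * (1 + Q * t) * t).
  by rewrite /df; field; rewrite !gt_eqF.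
by rewrite pmulr_lle0 ?subr_le0// invr_gt0 !mulr_gt0.
Qed.

Lemma ln2_ge : 2 / 3 <= ln 2 :> R.
Proof.
rewrite -ler_expR lnK ?posrE//.
(* From [exp (-s) >= 1 - s] at [s = 1/24] comes [exp (1/24) <= 24/23]; the sixteenth power of this
   is still below 2. *)
have -> : 2 / 3 = 16%:R * 24^-1 :> R by lra.
rewrite expRM_natl.
have h : expR (24^-1) <= 24 / 23 :> R.
  have := expR_ge1Dx (- 24^-1 : R); rewrite expRN.
  have e0 := expR_gt0 (24^-1 : R).
  by move=> /(ler_wpM2r (ltW e0)); rewrite mulVf ?gt_eqF//; lra.
apply: (@le_trans _ _ ((24 / 23) ^+ 16)).
  by rewrite lerXn2r// ?nnegrE ?expR_ge0//; lra.
have q1 : (24 / 23) ^+ 2 <= 1089 / 1000 :> R by lra.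
have -> : (24 / 23) ^+ 16 = (((24 / 23) ^+ 2) ^+ 2) ^+ 4 :> R by rewrite -!exprM.
have q2 : ((24 / 23) ^+ 2) ^+ 2 <= 1186 / 1000 :> R by lra.
apply: (@le_trans _ _ ((1186 / 1000) ^+ 4)).
  by rewrite lerXn2r// nnegrE; lra.
lra.
Qed.

End LogFacts.

Section Schedule.
Context {R : realType}.
Variables (K : nat) (a : R).
Hypothesis K_ge2 : (2 <= K)%N.
Hypothesis a_gt0 : 0 < a.
Hypothesis a_le : a <= K%:R * ln 2 / ln K%:R - 1.

Definition sp_h k : R := sp_r K a k / 2.
Definition sp_c : R := K%:R / (4 * (1 + a^-1) * sp_omega K a 0).
(** The decrease per step of the logarithm of the power of [K] inside the softplus; successive
    powers have the ratio [Q = exp sp_step]. *)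
Definition sp_step : R := (1 + a) * ln K%:R / K%:R.

Local Notation om := (sp_omega K a).
Let Q : R := expR sp_step.
Let X k : R := K%:R `^ (a - (a + 1) * k%:R / K%:R).

Let K0 : 0 < K%:R :> R. Proof. by rewrite ltr0n; case: K K_ge2. Qed.
Let Kn : K%:R != 0 :> R. Proof. by rewrite gt_eqF. Qed.
Let an : a != 0. Proof. by rewrite gt_eqF. Qed.
Let a1n : 1 + a != 0. Proof. by rewrite gt_eqF// addr_gt0. Qed.
Let lnK0 : 0 < ln K%:R :> R. Proof. by rewrite ln_gt0// ltr1n. Qed.
Let ln20 : 0 < ln 2 :> R. Proof. by rewrite ln_gt0// ltr1n. Qed.

Lemma sp_step_gt0 : 0 < sp_step.
Proof. by rewrite divr_gt0// mulr_gt0// addr_gt0. Qed.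

(** The hypothesis on [a], rearranged. It amounts to [Q <= 2], and hence yields [h <= 1]. *)
Lemma sp_step_le : sp_step <= ln 2.
Proof.
rewrite /sp_step ler_pdivrMr// -ler_pdivlMr// [ln 2 * _]mulrC; move: a_le; lra.
Qed.

Let Q1 : 1 < Q. Proof. by rewrite expR_gt1 sp_step_gt0. Qed.
Let Q2 : Q <= 2.
Proof. by rewrite -[leRHS]lnK ?posrE// ler_expR sp_step_le. Qed.
(** On [[1, 2]] the logarithm lies above its chord, so [sp_step = ln Q >= (Q - 1) ln 2], and
    [ln 2 >= 2/3]. *)
Let Q_step : (Q - 1) <= 3 / 2 * sp_step.
Proof.
have l1 : 0 <= Q - 1 <= 1 by move: (Q1) (Q2) => *; apply/andP; split; lra.
have := @ln_scale_le R 2 (Q - 1) ltac:(lra) l1.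
have -> : 1 + (Q - 1) * (2 - 1) = Q by ring.
rewrite expRK => h.
have := ler_wpM2l (andP l1).1 (@ln2_ge R); lra.
Qed.

Let XE k : X k = expR ((a - (a + 1) * k%:R / K%:R) * ln K%:R).
Proof. by rewrite /X /powR (negbTE Kn). Qed.
Let X0 k : 0 < X k. Proof. by rewrite XE expR_gt0. Qed.
Let X1 k : 0 < 1 + X k. Proof. by rewrite addr_gt0. Qed.
Let XS k : X k = Q * X k.+1.
Proof.
rewrite !XE /Q -expRD; congr expR; rewrite /sp_step -natr1; field; exact: Kn.
Qed.

Let QX1 k : 0 < 1 + Q * X k.+1. Proof. by rewrite -XS X1. Qed.

Lemma sp_omega_gt0 k : 0 < om k.
Proof. by rewrite ln_gt0// ltrDl X0. Qed.
Let omn k : om k != 0. Proof. by rewrite gt_eqF// sp_omega_gt0. Qed.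

(** Index 0 lies outside the schedule; since [0.-1 = 0], the formula gives there the value that
    empties the averages at time 1. *)
Lemma sp_h0 : sp_h 0 = 0.
Proof. by rewrite /sp_h /sp_r /= divff ?omn// subrr mulr0 mul0r. Qed.

Lemma sp_hE k : sp_h k = om k.-1 / om k - 1.
Proof. by rewrite /sp_h /sp_r mulrAC divff ?mul1r// pnatr_eq0. Qed.

Lemma sp_omegaE k : om k = (1 + sp_h k.+1) * om k.+1.
Proof. by rewrite sp_hE /= subrKC divfK. Qed.

Let omS k : om k = ln (1 + Q * X k.+1).
Proof. by rewrite /sp_omega -/(X k) XS. Qed.

Let dom k : om k - om k.+1 = sp_h k.+1 * om k.+1.
Proof. by rewrite sp_omegaE; ring. Qed.

Lemma sp_h_gt0 k : 0 < sp_h k.+1.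
Proof.
rewrite sp_hE subr_gt0 ltr_pdivlMr ?sp_omega_gt0// mul1r (omS k).
have h : X k.+1 < Q * X k.+1 by rewrite -[ltLHS]mul1r ltr_pM2r ?X0.
by rewrite ltr_ln ?posrE ?(X1 k.+1) ?QX1// ltrD2l.
Qed.

Lemma sp_h_ge0 k : 0 <= sp_h k.
Proof. by case: k => [|k]; rewrite ?sp_h0// ltW// sp_h_gt0. Qed.

(** Log-concavity of [om]: with [om k = ln (1 + Q X_(k+1))] the ratio of neighbours is the quotient
    of [ln1D_quot_le], and [X] decreases in [k]. *)
Lemma sp_h_mono k : sp_h k.-1 <= sp_h k.
Proof.
case: k => [//|[|k]] /=; first by rewrite sp_h0 sp_h_ge0.
rewrite !sp_hE /= lerD2r.
have h : X k.+2 <= X k.+1 by rewrite [leRHS]XS ler_peMl// ltW// X0.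
by have := ln1D_quot_le (ltW Q1) (X0 k.+2) h; rewrite -!omS.
Qed.

Let dom_le k : om k - om k.+1 <= (Q - 1) * (X k.+1 / (1 + X k.+1)).
Proof.
rewrite (omS k) /sp_omega -/(X k.+1) -ln_div ?posrE ?X1 ?QX1//.
have -> : (1 + Q * X k.+1) / (1 + X k.+1) = 1 + (Q - 1) * (X k.+1 / (1 + X k.+1)).
  by field; rewrite gt_eqF// X1.
apply: le_ln1Dx; apply: (@lt_le_trans _ _ 0); first by rewrite oppr_lt0.
by rewrite mulr_ge0 ?divr_ge0 ?(ltW (X0 _)) ?(ltW (X1 _))// subr_ge0 ltW.
Qed.

Let dom_le_step k : om k - om k.+1 <= sp_step.
Proof.
rewrite (omS k) /sp_omega -/(X k.+1) -ln_div ?posrE ?X1 ?QX1//.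
rewrite -[leRHS]expRK ler_ln ?posrE ?expR_gt0 ?divr_gt0 ?X1 ?QX1//.
rewrite ler_pdivrMr ?X1// -/Q mulrDr mulr1 lerD2r; exact: ltW.
Qed.

(** Both sides are multiplied by [om]; then [dom_le] and [X / (1 + X) <= ln (1 + X)] combine. *)
Let h_le k : sp_h k <= Q - 1.
Proof.
case: k => [|k]; first by rewrite sp_h0 subr_ge0 ltW.
have := dom_le k; rewrite dom.
have le1 : X k.+1 / (1 + X k.+1) <= om k.+1.
  have := le_ln1Dx (x := - (X k.+1 / (1 + X k.+1))).
  rewrite (_ : 1 - _ = (1 + X k.+1)^-1); last by field; rewrite gt_eqF// X1.
  rewrite lnV ?posrE ?X1// lerN2; apply.
  by rewrite ltrN2 ltr_pdivrMr ?X1// mul1r ltrDr.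
move=> h; have := le_trans h (ler_wpM2l _ le1).
by rewrite ler_pM2r ?sp_omega_gt0//; apply; rewrite subr_ge0 ltW.
Qed.

Lemma sp_h_le1 k : sp_h k <= 1.
Proof. by have := h_le k; move: (Q2); lra. Qed.

Lemma sp_h_le_step k : sp_h k <= 2 * sp_step.
Proof. by have := h_le k; have := Q_step; have := sp_step_gt0; lra. Qed.

Lemma sp_omega0_ge : 2 / 3 <= om 0%N.
Proof.
apply: (le_trans ln2_ge); rewrite /sp_omega ler_ln ?posrE ?addr_gt0 ?X0//.
rewrite (_ : 2 = 1 + 1)// lerD2l mulr0 mul0r subr0.
rewrite -[leLHS](@powRr0 _ (K%:R)); apply: ler_powR; last exact: ltW.
by rewrite ler1n (leq_trans _ K_ge2).
Qed.

Lemma sp_c_gt0 : 0 < sp_c.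
Proof. by rewrite divr_gt0// !mulr_gt0 ?sp_omega_gt0// addr_gt0// invr_gt0. Qed.

(** The product is [a ln K / (4 om 0)], and [om 0 = ln (1 + K^a)] exceeds [a ln K]. *)
Let c_step : sp_c * sp_step <= 4^-1.
Proof.
have o0 := sp_omega_gt0 0.
have -> : sp_c * sp_step = 4^-1 * (a * ln K%:R / om 0%N).
  rewrite /sp_c /sp_step; field.
  rewrite Kn an omn /= (_ : a + 1 = 1 + a) ?a1n//; last by ring.
rewrite ler_piMr// ler_pdivrMr// mul1r /sp_omega mulr0 mul0r subr0 -ln_powR.
rewrite ler_ln ?posrE ?powR_gt0// ?addr_gt0 ?powR_gt0//.
by rewrite lerDr.
Qed.

(** The step-size condition of [energy_step]. By [c_step] it suffices to bound [1 + h] times the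
    decrement of [om] by [9/5] of [sp_step]. *)
Lemma sp_small k : 2 * sp_h k * (sp_c * om k.-1) <= 9 / 10.
Proof.
case: k => [|k]; first by rewrite sp_h0; lra.
rewrite /= sp_omegaE.
have -> : 2 * sp_h k.+1 * (sp_c * ((1 + sp_h k.+1) * om k.+1))
   = 2 * sp_c * ((1 + sp_h k.+1) * (om k - om k.+1)) by rewrite dom; ring.
have c0 := sp_c_gt0; have s0 := sp_step_gt0; have hk := sp_h_ge0 k.+1.
suff h : (1 + sp_h k.+1) * (om k - om k.+1) <= 9 / 5 * sp_step.
  have := ler_wpM2l (ltW c0) h; have := c_step; lra.
have d0 : 0 <= om k - om k.+1 by rewrite dom mulr_ge0// ltW// sp_omega_gt0.
(* For large [X] the decrement is at most [sp_step] and [h <= 4/5], because [ln 2 <= 4/5 ln (5/2)].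
   For small [X] only [h <= 1] is available, but the decrement is at most [3/2 * 3/5 = 9/10] of
   [sp_step]. *)
have [Xbig|/ltW Xsmall] := leP (3 / 2) (X k.+1).
  apply: ler_pM => //; first by rewrite addr_ge0.
  suff : sp_h k.+1 <= 4 / 5 by lra.
  have omb : ln (5 / 2) <= om k.+1.
    rewrite /sp_omega -/(X k.+1) ler_ln ?posrE ?X1//; lra.
  have l5 : 5 * ln 2 <= 4 * ln (5 / 2) :> R.
    have -> : 5 * ln 2 = ln (2 ^+ 5) :> R by rewrite lnXn// mulr_natl.
    have -> : 4 * ln (5 / 2) = ln ((5 / 2) ^+ 4) :> R by rewrite mulr_natl lnXn//; lra.
    rewrite ler_ln ?posrE ?exprn_gt0//; lra.
  have hle : sp_h k.+1 * om k.+1 <= ln 2.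
    by rewrite -dom (le_trans (dom_le_step k))// sp_step_le.
  rewrite -(ler_pM2r (sp_omega_gt0 k.+1)); lra.
have hle := dom_le k.
have x35 : X k.+1 / (1 + X k.+1) <= 3 / 5 by rewrite ler_pdivrMr ?X1//; lra.
have xx : 0 <= Q - 1 by rewrite subr_ge0 ltW.
have h2 : om k - om k.+1 <= 9 / 10 * sp_step.
  have := ler_wpM2l xx x35; have := Q_step; lra.
have -> : 9 / 5 * sp_step = 2 * (9 / 10 * sp_step) by field.
apply: ler_pM => //; first by rewrite addr_ge0.
have := sp_h_le1 k.+1; lra.
Qed.

(** The exponent at [K] is [-1], so [om K.-1 = ln (1 + Q / K) <= 2 / K], which cancels the factor
    [K] of [sp_c]. This is the scale condition of [residual_le] at the last index. *)
Lemma sp_c_omega_last : sp_c * om K.-1 <= 1.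
Proof.
have KE : K = K.-1.+1 by rewrite prednK// (leq_trans _ K_ge2).
have XK : X K = K%:R^-1.
  rewrite /X -[RHS](powR_inv1 (ltW K0)); congr (_ `^ _).
  by field; exact: Kn.
have omK : om K.-1 <= 2 / K%:R.
  rewrite omS -KE XK; apply: (le_trans (le_ln1Dx _)).
    by apply: (lt_trans (ltrN10 R)); rewrite mulr_gt0// ?expR_gt0// invr_gt0.
  by rewrite ler_pM2r// invr_gt0.
have c0 := sp_c_gt0.
apply: (le_trans (ler_wpM2l (ltW c0) omK)).
have o0 := sp_omega0_ge; have op := sp_omega_gt0 0.
rewrite /sp_c.
have -> : K%:R / (4 * (1 + a^-1) * om 0%N) * (2 / K%:R) = (2 * (1 + a^-1) * om 0%N)^-1.
  field; rewrite an omn Kn (_ : a + 1 = 1 + a) ?a1n//; by ring.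
rewrite invf_le1 ?mulr_gt0 ?addr_gt0 ?invr_gt0//.
have ai : 0 < a^-1 by rewrite invr_gt0.
have := mulr_gt0 ai op; lra.
Qed.

Lemma sp_lambdaE k : sp_lambda K a k = 2 * sp_h k * (sp_c * om k.-1) * sp_u K a k.
Proof. by rewrite /sp_lambda /sp_h /sp_c; field; rewrite ?an ?omn ?a1n (_ : a + 1 = 1 + a) ?a1n//; ring. Qed.

Lemma sp_u_bound k : 0 <= sp_u K a k <= 2^-1.
Proof.
have h := sp_h_ge0 k; have -> : sp_u K a k = 6 * sp_h k / (2 * (1 + 2 * sp_h k) * (2 + 2 * sp_h k)).
  rewrite /sp_u (_ : sp_r K a k = 2 * sp_h k)//; last by rewrite /sp_h; field.
  by congr (_ / _); ring.
have d0 : 0 < 2 * (1 + 2 * sp_h k) * (2 + 2 * sp_h k) by rewrite !mulr_gt0//; lra.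
apply/andP; split; first by apply: divr_ge0; [rewrite mulr_ge0 | exact: ltW].
by rewrite ler_pdivrMr//; have := mulr_ge0 h h; lra.
Qed.

Lemma sp_lambda_bound k : 0 <= sp_lambda K a k <= 2^-1.
Proof.
have /andP[u0 u1] := sp_u_bound k.
have c0 : 0 <= 2 * sp_h k * (sp_c * om k.-1).
  apply: mulr_ge0; first by rewrite mulr_ge0 ?sp_h_ge0.
  by apply: mulr_ge0; apply: ltW; [exact: sp_c_gt0|exact: sp_omega_gt0].
rewrite sp_lambdaE mulr_ge0//= -[leRHS]mul1r; apply: ler_pM => //.
by apply: (le_trans (sp_small k)); lra.
Qed.

End Schedule.

(** * Closed form of the iterates through the averaged observed residual *)

Section IKMPath.
Context {R : realType} {V : lmodType R}.
Variables (K : nat) (a : R).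
Hypothesis K_ge2 : (2 <= K)%N.
Hypothesis a_gt0 : 0 < a.
Hypothesis a_le : a <= K%:R * ln 2 / ln K%:R - 1.
Local Notation h := (sp_h K a).
Local Notation om := (sp_omega K a).
Local Notation c := (sp_c K a).
Variables (x y z gam : nat -> V).
Hypothesis iKM : forall k, (1 <= k <= K)%N ->
  [/\ y k = x k + sp_alpha K a k *: (x k - x k.-1),
      z k = x k + sp_beta K a k *: (x k - x k.-1)
    & x k.+1 = (1 - sp_lambda K a k) *: y k + sp_lambda K a k *: (z k - gam k)].
Let W := running_avg h 0 gam.

Let W1 : W 1 = 0.
Proof. by rewrite /W running_avgS running_avg0 sp_h0// mulr0 scale0r !addr0 scaler0. Qed.

Let WS k : W k.+1 = (1 + 2 * h k)^-1 *: (W k + (2 * h k) *: gam k).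
Proof. by []. Qed.

Let lam1 k : 1 - sp_lambda K a k != 0.
Proof.
have /andP[_ h] := sp_lambda_bound K_ge2 a_gt0 a_le k.
by rewrite gt_eqF//; lra.
Qed.

(** The formula for [alpha] is the one with [(1 - lambda) alpha + lambda beta = u beta], which
    eliminates [y k]. *)
Let xS k : (1 <= k <= K)%N ->
  x k.+1 = x k + sp_u K a k *: (z k - x k) - sp_lambda K a k *: gam k.
Proof.
move=> kK; have [-> zE ->] := iKM kK.
have -> : z k - x k = sp_beta K a k *: (x k - x k.-1) by rewrite zE addrC addKr.
rewrite zE /sp_alpha; have := lam1 k.
move: (sp_lambda _ _ _) (sp_u _ _ _) (sp_beta _ _ _) (gam k) (x k) (x k - x k.-1) => l u b g v w ln.
rewrite scalerBr !scalerDr !scalerA !addrA [_ + l *: v]addrAC -scalerDl subrK scale1r; congr (_ - _).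
rewrite -addrA -scalerDl; congr (_ + _ *: _); field; exact: ln.
Qed.

Let omn k : om k != 0. Proof. by rewrite gt_eqF// sp_omega_gt0. Qed.

Let step k : (1 <= k <= K)%N -> z k = x k - (c * om k.-1) *: W k ->
  x k.+1 = x k - (3 * c / 2 * (om k.-1 - om k)) *: W k.+1.
Proof.
case: k => // k kK zE; rewrite (xS kK) WS /=.
have h0 := sp_h_ge0 K_ge2 a_gt0 k.+1.
have h1 : 1 + 2 * h k.+1 != 0 by rewrite gt_eqF//; lra.
have h2 : 1 + h k.+1 != 0 by rewrite gt_eqF//; lra.
have uE : sp_u K a k.+1 = 3 * h k.+1 / (2 * (1 + 2 * h k.+1) * (1 + h k.+1)).
  have rE : sp_r K a k.+1 = 2 * h k.+1 by rewrite /sp_h; field.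
  by rewrite /sp_u rE; field; rewrite h1 h2 gt_eqF//; lra.
pose A := sp_u K a k.+1 * (c * om k).
have omE := sp_omegaE a K_ge2 k.
have CE : 3 * c / 2 * (om k - om k.+1) * (1 + 2 * h k.+1)^-1 = A.
  by rewrite /A uE omE; field; rewrite h1 h2.
have lE : sp_lambda K a k.+1 = A * (2 * h k.+1).
  by rewrite sp_lambdaE// /A /=; ring.
have -> : z k.+1 - x k.+1 = - ((c * om k) *: W k.+1) by rewrite zE addrC addKr.
rewrite scalerN scalerA -/A [in RHS]scalerA.
by rewrite CE scalerDr scalerA -lE opprD addrA.
Qed.

(** Induction that alternates with [step]. Since [beta] at the next index is [2 / (3 h_k)], it turns
    the displacement coefficient [3c/2 * h_k om_k] into [c om_k]. *)
Lemma iKM_z k : (1 <= k <= K)%N -> z k = x k - (c * om k.-1) *: W k.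
Proof.
elim: k => [//|[|k] IH] kK.
  have [_ -> _] := iKM kK.
  by rewrite W1 /sp_beta /= scale0r scaler0 subr0 addr0.
have kK' : (1 <= k.+1 <= K)%N by move: kK => /= /ltnW.
have := step kK' (IH kK'); rewrite /= => xE.
have [_ -> _] := iKM kK.
have dE : x k.+2 - x k.+1 = - ((3 * c / 2 * (om k - om k.+1)) *: W k.+2).
  by rewrite xE addrC addKr.
rewrite /= dE /sp_beta /= scalerN scalerA; congr (_ - _ *: _).
rewrite (sp_omegaE a K_ge2 k).
have h0 := sp_h_gt0 K_ge2 a_gt0 k.
have -> : sp_r K a k.+1 = 2 * h k.+1 by rewrite /sp_h; field.
by field; rewrite gt_eqF.
Qed.

Lemma iKM_x k : (1 <= k <= K)%N ->
  x k.+1 = x k - (3 * c / 2 * (om k.-1 - om k)) *: W k.+1.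
Proof. by move=> kK; apply: step => //; exact: iKM_z. Qed.

Lemma iKM_xz k : (1 <= k <= K)%N -> x k - z k = (1 * (c * om k.-1)) *: W k.
Proof. by move=> kK; rewrite (iKM_z kK) subKr mul1r. Qed.

Lemma iKM_yz k : (1 <= k <= K)%N ->
  exists2 s, `|s| <= 2 & y k - z k = (s * (c * om k.-1)) *: W k.
Proof.
move=> kK; set th := (sp_u K a k - sp_lambda K a k) / (1 - sp_lambda K a k).
have /andP[u0 u1] := sp_u_bound K_ge2 a_gt0 k.
have /andP[l0 l1] := sp_lambda_bound K_ge2 a_gt0 a_le k.
have th1 : `|th| <= 1.
  rewrite /th normrM normfV ler_pdivrMr; last by rewrite normr_gt0 lam1.
  rewrite mul1r (ger0_norm (_ : 0 <= 1 - _)); last by lra.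
  by rewrite ler_norml; apply/andP; split; lra.
(* [y k] is [x k + th (z k - x k)], so its distance to [z k] is the fraction [1 - th] of that of
   [x k]. *)
exists (1 - th).
  move: th1; rewrite !ler_norml => /andP[? ?]; apply/andP; split; lra.
have zE := iKM_z kK; have [yE zE' _] := iKM kK.
have -> : y k = x k + th *: (z k - x k).
  rewrite yE zE' [X in th *: X]addrC addKr scalerA; congr (_ + _ *: _).
rewrite zE [x k - _ - x k]addrC addKr scalerN opprB addrAC addrCA subrr addr0.
by rewrite scalerA -scalerBl -[in X in X - _](mul1r (c * _)) -mulrBl.
Qed.

End IKMPath.

(** * Strong measurability and second moments *)

Section SigmaAlgebra.
Context {T : pointedType} (G : set (set T)).
Hypothesis saG : sigma_algebra [set: T] G.

Let GE (A : set T) : G A <-> @measurable _ (g_sigma_algebraType G) A.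
Proof. by rewrite -[in X in X <-> _](sigma_algebra_id saG). Qed.

Lemma sigma_algebraT : G setT.
Proof. by rewrite GE; exact: measurableT. Qed.

Lemma sigma_algebraI A B : G A -> G B -> G (A `&` B).
Proof. by rewrite !GE; exact: measurableI. Qed.

Lemma sigma_algebra_fin_bigcup (I : choiceType) (D : set I) (F : I -> set T) :
  finite_set D -> (forall i, D i -> G (F i)) -> G (\bigcup_(i in D) F i).
Proof.
move=> fD FG; rewrite GE; apply: fin_bigcup_measurable => // i /FG; by rewrite GE.
Qed.

Lemma sigma_algebra_bigcap (F : nat -> set T) (D : set nat) :
  (forall i, D i -> G (F i)) -> G (\bigcap_(i in D) F i).
Proof.
move=> FG; rewrite GE; apply: bigcap_measurableType => // i /FG; by rewrite GE.
Qed.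

End SigmaAlgebra.

Section StrongMeasurability.
Context {d : measure_display} {Omega : measurableType d} {R : realType}.
Variable G : set (set Omega).
Hypothesis saG : sigma_algebra [set: Omega] G.

Section Simple.
Context {H : normedModType R}.
Implicit Types s : Omega -> H.

Lemma simple_preimage s (A : set H) : simple_wrt G s -> G (s @^-1` A).
Proof.
move=> [fs Gs].
have -> : s @^-1` A = \bigcup_(h in range s `&` A) s @^-1` [set h].
  apply/seteqP; split => [w /= Aw|w [h [_ Ah] /= ->]//].
  by exists (s w) => //; split => //; exists w.
apply: sigma_algebra_fin_bigcup => //; exact: finite_setIl.
Qed.

Lemma simple_wrt_comp2 (H1 H2 : normedModType R) (phi : H1 -> H2 -> H)
    (s : Omega -> H1) (t : Omega -> H2) :
  simple_wrt G s -> simple_wrt G t -> simple_wrt G (fun w => phi (s w) (t w)).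
Proof.
move=> [fs Gs] [ft Gt]; split.
  have /sub_finite_set : range (fun w => phi (s w) (t w)) `<=`
      (fun p => phi p.1 p.2) @` (range s `*` range t).
    by move=> _ [w _ <-]; exists (s w, t w) => //; split; exists w.
  by apply; apply: finite_image; exact: finite_setX.
move=> h.
have -> : (fun w => phi (s w) (t w)) @^-1` [set h] =
    \bigcup_(p in (range s `*` range t) `&` [set p | phi p.1 p.2 = h])
      (s @^-1` [set p.1] `&` t @^-1` [set p.2]).
  apply/seteqP; split => [w /= phw|w [p [_ /= ph] [/= -> ->]]//].
  by exists (s w, t w) => //; split => //; split; exists w.
apply: sigma_algebra_fin_bigcup => //.
  by apply: finite_setIl; exact: finite_setX.
by move=> p _; apply: sigma_algebraI.
Qed.

Lemma simple_wrt_cst (h : H) : simple_wrt G (cst h).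
Proof.
split; first by apply: (@sub_finite_set _ _ [set h]) => //; move=> _ [w _ <-].
move=> h'; have [->|hh'] := eqVneq h h'.
  by rewrite (_ : _ @^-1` _ = setT);
    [exact: sigma_algebraT|apply/seteqP; split].
rewrite (_ : _ @^-1` _ = set0); first by case: saG.
by apply/seteqP; split => w //= hE; move/eqP: hh'.
Qed.

End Simple.

Section Closure.
Context {H1 H2 H : normedModType R}.

Lemma strongly_measurable_comp2 (phi : H1 -> H2 -> H) (f : Omega -> H1)
    (g : Omega -> H2) :
  (forall (u : nat -> H1) (v : nat -> H2) a b, u n @[n --> \oo] --> a -> v n @[n --> \oo] --> b ->
     phi (u n) (v n) @[n --> \oo] --> phi a b) ->
  strongly_measurable G f -> strongly_measurable G g ->
  strongly_measurable G (fun w => phi (f w) (g w)).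
Proof.
move=> cphi [s [sG sf]] [t [tG tg]].
exists (fun n w => phi (s n w) (t n w)); split => [n|w].
  exact: simple_wrt_comp2.
by apply: cphi; [exact: sf|exact: tg].
Qed.

Lemma strongly_measurable_cst (h : H) : strongly_measurable G (cst h : Omega -> H).
Proof.
exists (fun=> cst h); split => [n|w]; first exact: simple_wrt_cst.
exact: cvg_cst.
Qed.

End Closure.

Section Module.
Context {H : normedModType R}.
Implicit Types f g : Omega -> H.

Lemma strongly_measurableD f g : strongly_measurable G f ->
  strongly_measurable G g -> strongly_measurable G (fun w => f w + g w).
Proof.
move=> mf mg; apply: (strongly_measurable_comp2 (phi := fun x y => x + y) _ mf mg).
by move=> u v a b ua vb; exact: cvgD.
Qed.

Lemma strongly_measurable_comp (phi : H -> H) f : (forall (u : nat -> H) a,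
    u n @[n --> \oo] --> a -> phi (u n) @[n --> \oo] --> phi a) ->
  strongly_measurable G f -> strongly_measurable G (fun w => phi (f w)).
Proof.
move=> cphi mf; apply: (strongly_measurable_comp2 (phi := fun x _ => phi x) _ mf mf).
by move=> u v a b ua _; exact: cphi.
Qed.

Lemma strongly_measurableZ (a : R) f : strongly_measurable G f ->
  strongly_measurable G (fun w => a *: f w).
Proof.
by apply: (strongly_measurable_comp (phi := fun x => a *: x)) => u b ub; exact: cvgZr.
Qed.

Lemma strongly_measurableB f g : strongly_measurable G f ->
  strongly_measurable G g -> strongly_measurable G (fun w => f w - g w).
Proof.
move=> mf mg; apply: (strongly_measurable_comp2 (phi := fun x y => x - y) _ mf mg).
by move=> u v a b ua vb; exact: cvgB.
Qed.

Lemma strongly_measurable_nonexp (T : H -> H) f : nonexpansive T ->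
  strongly_measurable G f -> strongly_measurable G (fun w => T (f w)).
Proof.
move=> nT; apply: (strongly_measurable_comp (phi := T)) => u a ua.
apply/cvgrPdist_le => e e0; move/cvgrPdist_le : ua => /(_ e e0).
by apply: filterS => n; apply: le_trans; exact: nT.
Qed.

End Module.
End StrongMeasurability.

Lemma strongly_measurableS {d : measure_display} {Omega : measurableType d} {R : realType}
    {H : normedModType R} (G G' : set (set Omega)) (f : Omega -> H) :
  G `<=` G' -> strongly_measurable G f -> strongly_measurable G' f.
Proof.
move=> GG' [s [sG sf]]; exists s; split => // n; have [fs Gs] := sG n.
by split => // h; exact/GG'.
Qed.

Section Measurability.
Context {d : measure_display} {Omega : measurableType d} {R : realType}
  {H : normedModType R}.

Lemma measurable_simple_comp (s : Omega -> H) (psi : H -> R) :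
  simple_wrt measurable s -> measurable_fun [set: Omega] (psi \o s).
Proof.
move=> ms _ B mB; rewrite setTI.
exact: (simple_preimage (@sigma_algebra_measurable _ Omega) (psi @^-1` B) ms).
Qed.

Lemma measurable_norm (f : Omega -> H) : strongly_measurable measurable f ->
  measurable_fun [set: Omega] (fun w => `|f w|).
Proof.
move=> [s [sm sf]].
apply: (@measurable_fun_cvg _ _ _ _ (fun n w => `|s n w|)) => //.
  by move=> n; exact: (measurable_simple_comp (fun h => `|h|) (sm n)).
by move=> w _; apply: cvg_norm; exact: sf.
Qed.

End Measurability.

Section Dot.
Context {R : realType} {H : normedModType R} (dot : {dot H for (@idfun R)}).
Hypothesis norm_dot : forall h : H, `|h| ^+ 2 = dot h h.
Lemma dotC u v : dot u v = dot v u.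
Proof. by have := hermC dot u v; rewrite expr0 mul1r. Qed.
Lemma dotDl u v w : dot (u + v) w = dot u w + dot v w.
Proof. exact: linearDl. Qed.
Lemma dotZl a u v : dot (a *: u) v = a * dot u v.
Proof. exact: linearZl_LR. Qed.
Lemma dot_ge0 u : 0 <= dot u u.
Proof. by rewrite -norm_dot sqr_ge0. Qed.
Lemma dot_eq0 u : dot u u = 0 -> u = 0.
Proof. by rewrite -norm_dot => /eqP; rewrite sqrf_eq0 normr_eq0 => /eqP. Qed.
Lemma dotDr u v w : dot w (u + v) = dot w u + dot w v.
Proof. by rewrite dotC dotDl !(dotC w). Qed.
Lemma dotZr a u v : dot v (a *: u) = a * dot v u.
Proof. by rewrite dotC dotZl (dotC v). Qed.
Lemma dotBr u v w : dot w (u - v) = dot w u - dot w v.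
Proof. by rewrite dotDr -scaleN1r dotZr mulN1r. Qed.
Lemma dot_sumr (I : Type) (r : seq I) (F : I -> H) u :
  dot u (\sum_(i <- r) F i) = \sum_(i <- r) dot u (F i).
Proof.
elim: r => [|i r IH]; last by rewrite !big_cons dotDr IH.
by rewrite !big_nil -(scale0r 0) dotZr mul0r.
Qed.
Lemma dot_polar (u v : H) : dot u v = 2^-1 * (`|u + v| ^+ 2 - `|u| ^+ 2 - `|v| ^+ 2).
Proof. rewrite !norm_dot !dotDl !dotDr (dotC v u); lra. Qed.
Lemma normD_sq (u v : H) : `|u + v| ^+ 2 <= 2 * `|u| ^+ 2 + 2 * `|v| ^+ 2.
Proof.
have := dot_ge0 (u - v); rewrite -norm_dot.
have : `|u + v| ^+ 2 + `|u - v| ^+ 2 = 2 * `|u| ^+ 2 + 2 * `|v| ^+ 2.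
  rewrite !norm_dot -(scaleN1r v) !dotDl !dotDr !dotZl !dotZr; ring.
lra.
Qed.
Lemma dot_le (u v : H) : `|dot u v| <= `|u| * `|v|.
Proof.
have [->|v0] := eqVneq v 0.
  by rewrite -(scale0r 0) dotZr mul0r !normr0 scale0r normr0 mulr0.
have vp : 0 < `|v| ^+ 2 by rewrite exprn_gt0// normr_gt0.
rewrite -(@ler_pXn2r _ 2) ?nnegrE ?mulr_ge0// real_normK ?num_real// exprMn.
have := dot_ge0 (`|v| ^+ 2 *: u - dot u v *: v).
rewrite -scaleNr !dotDl !dotDr !dotZl !dotZr (dotC v u) -!norm_dot => h.
have : 0 <= `|v| ^+ 2 * (`|u| ^+ 2 * `|v| ^+ 2 - dot u v ^+ 2) by move: h; lra.
by rewrite pmulr_rge0// subr_ge0.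
Qed.
End Dot.

Section L2.
Context {d : measure_display} {Omega : measurableType d} {R : realType}
  {H : normedModType R} (dot : {dot H for (@idfun R)}).
Hypothesis norm_dot : forall h : H, `|h| ^+ 2 = dot h h.
Variable P : probability Omega R.
Implicit Types f g : Omega -> H.

Let saM := @sigma_algebra_measurable _ Omega.

Definition integrableR (f : Omega -> R) := P.-integrable [set: Omega] (EFin \o f).

Lemma integrableRD (f g : Omega -> R) : integrableR f -> integrableR g ->
  integrableR (fun w => f w + g w).
Proof. exact: integrableD. Qed.
Lemma integrableRZ (a : R) (f : Omega -> R) : integrableR f ->
  integrableR (fun w => a * f w).
Proof. exact: integrableZl. Qed.
Lemma integrableRB (f g : Omega -> R) : integrableR f -> integrableR g ->
  integrableR (fun w => f w - g w).
Proof. exact: integrableB. Qed.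
Lemma integrableR_cst (a : R) : integrableR (fun=> a).
Proof. by have := @finite_measure_integrable_cst _ _ _ P [set: Omega] a measurableT. Qed.

Lemma le_integrableR (f g : Omega -> R) : measurable_fun setT f ->
  (forall w, `|f w| <= g w) -> integrableR g -> integrableR f.
Proof.
move=> mf fg; apply: le_integrable => //; first exact/measurable_EFinP.
by move=> w _ /=; rewrite lee_fin (le_trans (fg w))// ler_norm.
Qed.

Definition L2 f := strongly_measurable measurable f /\
  integrableR (fun w => `|f w| ^+ 2).

Lemma L2D f g : L2 f -> L2 g -> L2 (fun w => f w + g w).
Proof.
move=> [mf If] [mg Ig]; have mfg := strongly_measurableD saM mf mg; split => //.
apply: (@le_integrableR _ (fun w => 2 * `|f w| ^+ 2 + 2 * `|g w| ^+ 2)).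
- by apply: measurable_funX; exact: measurable_norm.
- by move=> w; rewrite ger0_norm ?sqr_ge0//; exact: normD_sq.
- by apply: integrableRD; exact: integrableRZ.
Qed.

Lemma L2Z (a : R) f : L2 f -> L2 (fun w => a *: f w).
Proof.
move=> [mf If]; split; first exact: strongly_measurableZ.
under eq_fun do rewrite normrZ exprMn.
exact: integrableRZ.
Qed.

Lemma L2B f g : L2 f -> L2 g -> L2 (fun w => f w - g w).
Proof.
move=> Lf Lg; have := L2D Lf (L2Z (-1) Lg).
by under eq_fun do rewrite scaleN1r.
Qed.

Lemma L2_cst (h : H) : L2 (cst h).
Proof. by split; [exact: strongly_measurable_cst|exact: (integrableR_cst (`|h| ^+ 2))]. Qed.

Lemma L2_nonexp (T : H -> H) f : nonexpansive T -> L2 f -> L2 (fun w => T (f w)).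
Proof.
move=> nT Lf; have [mf If] := Lf; have mT := strongly_measurable_nonexp saM nT mf.
split => //.
have [_ I1] := L2D (L2Z 1 Lf) (L2_cst 0).
apply: (@le_integrableR _ (fun w => 2 * `|f w| ^+ 2 + 2 * `|T 0| ^+ 2)).
- by apply: measurable_funX; exact: measurable_norm.
- move=> w; rewrite ger0_norm ?sqr_ge0//.
  rewrite -[T (f w)](subrK (T 0)); apply: (le_trans (normD_sq norm_dot _ _)).
  by rewrite lerD2r ler_pM2l// lerXn2r ?nnegrE//; have := nT (f w) 0; rewrite subr0.
- by apply: integrableRD; apply: integrableRZ => //; exact: (integrableR_cst (`|T 0| ^+ 2)).
Qed.

Lemma integrable_dot f g : L2 f -> L2 g -> integrableR (fun w => dot (f w) (g w)).
Proof.
move=> Lf Lg; have [_ Ifg] := L2D Lf Lg; have [_ If] := Lf; have [_ Ig] := Lg.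
under eq_fun do rewrite (dot_polar norm_dot).
by apply: integrableRZ; apply: integrableRB => //; exact: integrableRB.
Qed.

Lemma L2_rms f : strongly_measurable measurable f -> (rms P f < +oo)%E -> L2 f.
Proof.
move=> mf rf; split => //; apply/integrableP; split.
  by apply/measurable_EFinP; apply: measurable_funX; exact: measurable_norm.
have -> : (\int[P]_w `|(EFin \o (fun w => `|f w| ^+ 2)%R) w| =
  'E_P[(fun w => `|f w| ^+ 2)%R])%E.
  by rewrite unlock; apply: eq_integral => w _ /=; rewrite ger0_norm// sqr_ge0.
by move: rf; rewrite /rms; case: ('E_P[_])%E => // r _; rewrite ltry.
Qed.

Lemma rms_sqr f : L2 f -> (rms P f = (Num.sqrt (\int[P]_w `|f w| ^+ 2))%:E)%E.
Proof.
move=> [mf If]; rewrite /rms unlock /Rintegral.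
by have /fineK <- := integrable_fin_num measurableT If.
Qed.

End L2.

(** * Noise of conditional mean zero is orthogonal to the past *)

Section Orthogonality.
Context {d : measure_display} {Omega : measurableType d} {R : realType}
  {H : normedModType R} (dot : {dot H for (@idfun R)}).
Hypothesis norm_dot : forall h : H, `|h| ^+ 2 = dot h h.
Variable P : probability Omega R.
Local Notation integrableR := (@integrableR _ Omega R P).

Lemma simple_decomp (s : Omega -> H) (phi : H -> R) w : finite_set (range s) ->
  phi (s w) = \sum_(h <- fset_set (range s)) phi h * \1_(s @^-1` [set h]) w.
Proof.
move=> fs; have sw : s w \in fset_set (range s).
  by rewrite in_fset_set; [apply/mem_set; exists w|exact: fs].
rewrite (bigD1_seq (s w) sw (fset_uniq _)) /= indicE mem_set//= mulr1 big1 ?addr0// => h /negP hs.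
rewrite indicE memNset ?mulr0//= => hE; apply: hs; exact/eqP.
Qed.

(** The integrand may depend on the sample point as well, so that a simple factor can be frozen on
    each of its level sets. *)
Lemma Rintegral_simple (s : Omega -> H) (phi : Omega -> H -> R) :
  simple_wrt measurable s ->
  (forall h, integrableR (phi^~ h)) ->
  integrableR (fun w => phi w (s w)) /\
  \int[P]_w (phi w (s w)) =
  \sum_(h <- fset_set (range s)) \int[P]_(w in s @^-1` [set h]) phi w h.
Proof.
move=> [fs ms] Iphi.
have mI h : P.-integrable setT (fun w => (phi w h * \1_(s @^-1` [set h]) w)%:E).
  apply: (@eq_integrable _ _ _ _ _ measurableT
    ((EFin \o phi^~ h) \_ (s @^-1` [set h]))).
    move=> w _; rewrite patchE indicE; case: (w \in _) => //=.
    - by rewrite mulr1.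
    - by rewrite mulr0.
  apply/(integrable_mkcond _ (ms h)).
  exact: integrableS (Iphi h).
have E w : (phi w (s w))%:E =
   (\sum_(h <- fset_set (range s)) (phi w h * \1_(s @^-1` [set h]) w)%:E)%E.
  by rewrite (simple_decomp (phi w))// sumEFin.
split.
  apply: (@eq_integrable _ _ _ _ _ measurableT
    (fun w => \sum_(h <- fset_set (range s)) (phi w h * \1_(s @^-1` [set h]) w)%:E)%E).
    by move=> w _; rewrite -E.
  exact: integrable_sum.
rewrite /Rintegral; under eq_integral do rewrite E.
rewrite integral_sum// -sum_fine; last first.
  by move=> h _; apply: integrable_fin_num.
apply: eq_bigr => h _; congr fine; rewrite [RHS]integral_mkcond.
apply: eq_integral => w _; rewrite patchE indicE; case: (w \in _) => /=.
- by rewrite mulr1.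
- by rewrite mulr0.
Qed.

Lemma strongly_measurable_simple (s : Omega -> H) :
  simple_wrt measurable s -> strongly_measurable measurable s.
Proof. by move=> ms; exists (fun=> s); split => // w; exact: cvg_cst. Qed.

Lemma dot_cvg (h : H) (u : nat -> H) a :
  u n @[n --> \oo] --> a -> dot h (u n) @[n --> \oo] --> dot h a.
Proof.
move=> ua; apply/cvgrPdist_le => e e0.
have h0 : 0 < `|h| + 1 by rewrite ltr_wpDl.
move/cvgrPdist_le : ua => /(_ (e / (`|h| + 1)) (divr_gt0 e0 h0)).
apply: filterS => n; rewrite ler_pdivlMr// => un.
rewrite -(dotBr dot) (le_trans (dot_le norm_dot _ _))// (le_trans _ un)// mulrC.
by rewrite ler_wpM2l// lerDl.
Qed.

Lemma measurable_dotl (h : H) (f : Omega -> H) : strongly_measurable measurable f ->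
  measurable_fun [set: Omega] (fun w => dot h (f w)).
Proof.
move=> [s [sm sf]].
apply: (@measurable_fun_cvg _ _ _ _ (fun n w => dot h (s n w))) => //.
  by move=> n; exact: (measurable_simple_comp (dot h) (sm n)).
by move=> w _; apply: dot_cvg; exact: sf.
Qed.

Lemma bochner_integrable_norm (f : Omega -> H) : bochner_integrable P f ->
  integrableR (fun w => `|f w|).
Proof.
move=> [mf If]; apply/integrableP; split.
  by apply/measurable_EFinP; exact: measurable_norm.
apply: le_lt_trans If; apply: ge0_le_integral => //.
- by do 2 apply: measurableT_comp => //; exact: measurable_norm.
- by apply/measurable_EFinP; exact: measurable_norm.
- by move=> w _ /=; rewrite normr_id.
Qed.

Lemma integrable_dotl (h : H) (f : Omega -> H) : strongly_measurable measurable f ->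
  integrableR (fun w => `|f w|) -> integrableR (fun w => dot h (f w)).
Proof.
move=> mf If; apply: (@le_integrableR _ _ _ _ _ (fun w => `|h| * `|f w|)).
- exact: measurable_dotl.
- by move=> w; exact: dot_le.
- exact: integrableRZ.
Qed.

Lemma integrableR_norm_simple (s : Omega -> H) : simple_wrt measurable s ->
  integrableR (fun w => `|s w|).
Proof.
move=> ms; have [] // := Rintegral_simple (phi := fun _ h => `|h|) ms.
by move=> h; exact: (integrableR_cst P `|h|).
Qed.

Lemma dot_simple_integral (A : set Omega) (s : Omega -> H) (h : H) :
  measurable A -> simple_wrt measurable s ->
  \int[P]_(w in A) dot h (s w) = dot h (simple_integral P A s).
Proof.
move=> mA ms; have [fs mfs] := ms.
have Iphi h' : integrableR (fun w => dot h h' * \1_A w).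
  by apply: integrableRZ; exact: integrable_indic.
have [_ E] := Rintegral_simple ms Iphi.
transitivity (\int[P]_w (dot h (s w) * \1_A w)).
  rewrite Rintegral_mkcond; apply: eq_Rintegral => w _.
  by rewrite patchE indicE; case: (w \in A); rewrite ?mulr1 ?mulr0.
rewrite E /simple_integral fsbig_finite// dot_sumr; apply: eq_bigr => h' _.
rewrite (dotZr dot) [RHS]mulrC RintegralZl//; last first.
  apply: (@integrableS _ _ _ P setT) => //.
  exact: integrable_indic.
by congr (_ * _); rewrite /Rintegral integral_indic// setIC.
Qed.

(** Pairing with [h] is linear and continuous, hence commutes with the integral: true for simple
    functions, then in the [L1] limit that defines [v]. *)
Lemma bochner_dot (A : set Omega) (f : Omega -> H) (v h : H) :
  measurable A -> bochner_integrable P f -> is_bochner_integral P A f v ->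
  \int[P]_(w in A) dot h (f w) = dot h v.
Proof.
move=> mA bf [s [ss sf sv]]; have [mf _] := bf; have If := bochner_integrable_norm bf.
have saM := @sigma_algebra_measurable _ Omega.
have ms n := strongly_measurable_simple (ss n).
have onA (g : Omega -> R) : integrableR g -> P.-integrable A (EFin \o g).
  exact: integrableS.
have Isub n : integrableR (fun w => `|f w - s n w|).
  apply: (@le_integrableR _ _ _ _ _ (fun w => `|f w| + `|s n w|)).
  - by apply: measurable_norm; exact: strongly_measurableB.
  - by move=> w; rewrite normr_id; exact: ler_normB.
  - by apply: integrableRD => //; exact: integrableR_norm_simple.
have r0 : \int[P]_(w in A) `|f w - s n w| @[n --> \oo] --> (0 : R).
  by move/fine_cvgP : sf => [].
have bound n : `|\int[P]_(w in A) dot h (f w) - dot h (simple_integral P A (s n))|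
    <= `|h| * \int[P]_(w in A) `|f w - s n w|.
  have Idf := onA _ (integrable_dotl h mf If).
  have Ids := onA _ (integrable_dotl h (ms n) (integrableR_norm_simple (ss n))).
  rewrite -(dot_simple_integral h mA (ss n)) -RintegralB//.
  apply: (le_trans (le_normr_Rintegral mA _)).
    by have := integrableB mA Idf Ids.
  rewrite -RintegralZl//; last exact: onA.
  apply: le_Rintegral => //.
  - by apply: integrable_norm; exact: (integrableB mA Idf Ids).
  - exact/onA/integrableRZ.
  - by move=> w _; rewrite -(dotBr dot); exact: dot_le.
have c1 : dot h (simple_integral P A (s n)) @[n --> \oo] --> dot h v by exact: dot_cvg.
suff c2 : dot h (simple_integral P A (s n)) @[n --> \oo] -->
    \int[P]_(w in A) dot h (f w) by exact: (cvg_unique (@Rhausdorff R) c2 c1).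
apply/cvgrPdist_le => e e0.
have h0 : 0 < `|h| + 1 by rewrite ltr_wpDl.
move/cvgrPdist_le : r0 => /(_ (e / (`|h| + 1)) (divr_gt0 e0 h0)).
apply: filterS => n; rewrite sub0r normrN ler_pdivlMr// => rn.
apply: (le_trans (bound n)); apply: le_trans rn.
apply: (le_trans (ler_wpM2l (normr_ge0 _) (ler_norm _))).
by rewrite mulrC ler_wpM2l// lerDl.
Qed.

Lemma simple_wrt_indic (G : set (set Omega)) (B : set Omega) :
  sigma_algebra [set: Omega] G -> G B -> simple_wrt G (\1_B : Omega -> R^o).
Proof.
move=> saG GB; have GC : G (~` B).
  by case: saG => _ GC _; rewrite -setTD; exact: GC.
split.
  apply: (@sub_finite_set _ _ ([set 0] `|` [set 1])); last first.
    by rewrite finite_setU; split; exact: finite_set1.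
  move=> _ [w _ <-]; rewrite indicE; case: (_ \in _); [by right|by left].
move=> r.
have -> : (\1_B : Omega -> R^o) @^-1` [set r] =
    (B `&` (cst (1 : R^o) @^-1` [set r])) `|` (~` B `&` (cst (0 : R^o) @^-1` [set r])).
  apply/seteqP; split => [w /=|w /=].
    rewrite indicE; have [wB|wB] := boolP (w \in B) => /= rE.
      by left; split => //; exact: set_mem.
    by right; split => // Bw; move/negP : wB; apply; exact: mem_set.
  by case=> [[wB <-]|[wB <-]]; rewrite indicE; [rewrite mem_set|rewrite memNset].
have [_ G1] := simple_wrt_cst saG (1 : R^o).
have [_ G0] := simple_wrt_cst saG (0 : R^o).
have -> : forall X Y : set Omega, X `|` Y = \bigcup_(i in [set: bool]) (if i then X else Y).
  move=> X Y; apply/seteqP; split => w.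
    by case=> ?; [exists true|exists false].
  by case=> [[]] _; [left|right].
apply: (sigma_algebra_fin_bigcup saG); first exact: finite_finset.
by case=> _; apply: (sigma_algebraI saG); [exact: GB|exact: G1|exact: GC|exact: G0].
Qed.

Lemma measurable_dot (f g : Omega -> H) :
  strongly_measurable measurable f -> strongly_measurable measurable g ->
  measurable_fun [set: Omega] (fun w => dot (f w) (g w)).
Proof.
move=> mf mg; have saM := @sigma_algebra_measurable _ Omega.
under eq_fun do rewrite (dot_polar norm_dot).
apply: measurable_funM => //; apply: measurable_funB; first apply: measurable_funB.
- by apply: measurable_funX; apply: measurable_norm; exact: strongly_measurableD.
- by apply: measurable_funX; exact: measurable_norm.
- by apply: measurable_funX; exact: measurable_norm.
Qed.

Lemma Rintegral_lim0 (f_ : nat -> Omega -> R) (f g : Omega -> R) :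
  (forall n, measurable_fun setT (f_ n)) ->
  (forall w, f_ n w @[n --> \oo] --> f w) ->
  (forall n w, `|f_ n w| <= g w) -> integrableR g ->
  (forall n, \int[P]_w f_ n w = 0) -> \int[P]_w f w = 0.
Proof.
move=> mf cf fg Ig f0.
have If n : integrableR (f_ n) by exact: le_integrableR (fg n) Ig.
have E n : (\int[P]_w (f_ n w)%:E)%E = 0%E.
  by rewrite -[LHS]fineK ?(integrable_fin_num measurableT (If n))// -/(Rintegral _ _ _) f0.
have c : (\int[P]_w (f_ n w)%:E)%E @[n --> \oo] --> (\int[P]_w (f w)%:E)%E.
  apply: (@dominated_cvg _ _ _ P setT measurableT (fun n w => (f_ n w)%:E)
    (fun w => (f w)%:E) (fun w => (g w)%:E)) => //.
  - by move=> n; apply/measurable_EFinP.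
  - by move=> w _; apply/fine_cvgP; split; [exact: nearW|exact: cf].
  - by move=> n w _ /=; rewrite lee_fin.
rewrite (_ : (fun n => (\int[P]_w (f_ n w)%:E)%E) = cst 0%E) in c; last exact/funext.
by rewrite /Rintegral (cvg_unique (@ereal_hausdorff R) c (cvg_cst _)).
Qed.

(** Constant [Theta] on an event of [G], then simple [Theta], then two dominated limits. The
    truncation between them is needed because the simple approximations of [Theta] come without any
    domination. *)
Lemma cond_mean_zero (G : set (set Omega)) (xi Theta : Omega -> H) :
  sigma_algebra [set: Omega] G -> G `<=` measurable ->
  is_cond_expectation P G xi (cst 0) -> L2 P xi ->
  strongly_measurable G Theta -> L2 P Theta ->
  \int[P]_w dot (xi w) (Theta w) = 0.
Proof.
move=> saG Gm [bxi b0 _ cE] [mxi Ixi2] [s [ss sT]] [mT IT2].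
have Ixi := bochner_integrable_norm bxi.
have onevent A h : G A -> \int[P]_(w in A) dot (xi w) h = 0.
  move=> GA; have [v iv iv0] := cE A GA; have mA := Gm _ GA.
  have := bochner_dot h mA b0 iv0; rewrite -(bochner_dot h mA bxi iv).
  rewrite [X in X = _ -> _](_ : _ = 0); last first.
    rewrite /Rintegral; under eq_integral do rewrite -(scale0r 0) (dotZr dot) mul0r.
    by rewrite integral0.
  by move=> E0; rewrite [RHS]E0; apply: eq_Rintegral => w _; rewrite (dotC dot).
have onsimple (t : Omega -> H) : simple_wrt G t -> \int[P]_w dot (xi w) (t w) = 0.
  move=> [ft Gt]; have mt : simple_wrt measurable t by split => // h; exact/Gm.
  have Iphi h : integrableR (fun w => dot (xi w) h).
    under eq_fun do rewrite (dotC dot).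
    exact: integrable_dotl.
  have [_ ->] := Rintegral_simple mt Iphi.
  by rewrite big1// => h _; exact: onevent.
(* The truncation uses the approximations and not [Theta], so it is visibly an event of [G]. Taking
   [maxn n m] in [t] below makes every approximation bounded by [n] on it. *)
pose B n := \bigcap_(m in [set m | (n <= m)%N]) (s m @^-1` [set h | `|h| <= n%:R]).
have GB n : G (B n).
  by apply: (sigma_algebra_bigcap saG) => m _; exact: simple_preimage.
pose t n m w : H := (\1_(B n) w : R^o) *: s (maxn n m) w.
have st n m : simple_wrt G (t n m).
  apply: (simple_wrt_comp2 saG (fun (a : R^o) (h : H) => a *: h)) => //.
  exact: simple_wrt_indic.
pose ThetaB n w : H := (\1_(B n) w : R^o) *: Theta w.
have tB n w : t n m w @[m --> \oo] --> ThetaB n w.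
  apply: cvgZr; apply: (@cvg_trans _ (s m w @[m --> \oo])); last exact: sT.
  apply: near_eq_cvg; near=> m; rewrite (maxn_idPr _)//.
  by near: m; exact: nbhs_infty_ge.
have mst n m : strongly_measurable measurable (t n m).
  apply: strongly_measurable_simple; have [ft Gt] := st n m.
  by split => // h; exact/Gm.
have saM := @sigma_algebra_measurable _ Omega.
have mB n : strongly_measurable measurable (ThetaB n).
  by exists (t n); split => // m; have [ft Gt] := st n m; split => // h; exact/Gm.
have cdot u (v : nat -> H) l : v m @[m --> \oo] --> l ->
    dot (xi u) (v m) @[m --> \oo] --> dot (xi u) l by exact: dot_cvg.
have intB n : \int[P]_w dot (xi w) (ThetaB n w) = 0.
  apply: (@Rintegral_lim0 (fun m w => dot (xi w) (t n m w)) _ (fun w => n%:R * `|xi w|)).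
  - by move=> m; exact: measurable_dot.
  - by move=> w; exact: cdot.
  - move=> m w; apply: (le_trans (dot_le norm_dot _ _)).
    rewrite mulrC ler_wpM2r// /t indicE.
    have [wB|_] := boolP (w \in B n); last by rewrite scale0r normr0.
    by rewrite scale1r; move/set_mem : wB => /(_ (maxn n m)); apply; exact: leq_maxl.
  - exact: integrableRZ.
  - by move=> m; exact: onsimple.
(* Each sample point lies in [B n] for large [n], since a convergent sequence is eventually bounded.
   Square integrability of both factors supplies the domination. *)
apply: (@Rintegral_lim0 (fun n w => dot (xi w) (ThetaB n w)) _
   (fun w => `|xi w| ^+ 2 + `|Theta w| ^+ 2)) => //.
- by move=> n; exact: measurable_dot.
- move=> w; apply: cdot.
  apply: (@cvg_trans _ ((fun=> Theta w) n @[n --> \oo])); last exact: cvg_cst.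
  apply: near_eq_cvg.
  have [N _ sN] : \forall m \near \oo, `|s m w| <= `|Theta w| + 1.
    have /cvgrPdist_le /(_ 1 ltr01) := sT w; apply: filterS => m h.
    rewrite -[s m w](subKr (Theta w)) (le_trans (ler_normB _ _))// lerD2l.
    exact: h.
  near=> n; rewrite /ThetaB indicE mem_set ?scale1r// => m /= nm.
  apply: (le_trans (sN m _)) => /=.
    by apply: leq_trans nm; near: n; exact: nbhs_infty_ge.
  apply: (@le_trans _ _ n%:R); first by near: n; exact: nbhs_infty_ger.
  by [].
- move=> n w; apply: (le_trans (dot_le norm_dot _ _)).
  have h : `|ThetaB n w| <= `|Theta w|.
    rewrite /ThetaB normrZ indicE; case: (_ \in _) => /=.
    + by rewrite normr1 mul1r.
    + by rewrite normr0 mul0r.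
  apply: (le_trans (ler_wpM2l (normr_ge0 _) h)).
  have := sqr_ge0 (`|xi w| - `|Theta w|); have := sqr_ge0 (`|xi w|); have := sqr_ge0 (`|Theta w|).
  rewrite sqrrB; lra.
- by apply: integrableRD.
Unshelve. all: by end_near. Qed.

End Orthogonality.

(** * The bound in mean square *)

Lemma discrete_gronwall {R : realType} (v e f : nat -> R) (n : nat) :
  (0 < n)%N ->
  (forall k, (1 <= k < n)%N -> 0 <= e k) -> (forall k, (1 <= k < n)%N -> 0 <= f k) ->
  (forall k, (1 <= k < n)%N -> v k.+1 <= (1 + e k) * v k + f k) ->
  0 <= v 1%N ->
  v n <= expR (\sum_(1 <= k < n) e k) * (v 1%N + \sum_(1 <= k < n) f k).
Proof.
case: n => // n _; elim: n => [|n IH] e0 f0 vS v1.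
  by rewrite !big_geq// expR0 mul1r addr0.
have lt k : (1 <= k < n.+1)%N -> (1 <= k < n.+2)%N.
  by move=> /andP[-> /leqW].
have {}IH := IH (fun k kn => e0 k (lt k kn)) (fun k kn => f0 k (lt k kn))
  (fun k kn => vS k (lt k kn)) v1.
have e1 : 0 <= e n.+1 by apply: e0; rewrite ltnSn.
have f1 : 0 <= f n.+1 by apply: f0; rewrite ltnSn.
have S0 : 0 <= \sum_(1 <= k < n.+1) e k.
  by rewrite big_nat; apply: sumr_ge0 => k kn; apply: e0; exact: lt.
have F0 : 0 <= \sum_(1 <= k < n.+1) f k.
  by rewrite big_nat; apply: sumr_ge0 => k kn; apply: f0; exact: lt.
apply: (le_trans (vS n.+1 _)); first by rewrite ltnSn.
rewrite !(big_nat_recr n.+1)//= expRD addrA [in leRHS]mulrDr.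
apply: lerD.
  apply: (le_trans (ler_wpM2l _ IH)); first by rewrite addr_ge0.
  rewrite mulrCA -mulrA ler_wpM2l ?expR_ge0//.
  by rewrite ler_wpM2r ?addr_ge0// expR_ge1Dx.
by rewrite ler_peMl// -expRD -expR0 ler_expR addr_ge0.
Qed.

Lemma sum_increments {R : realType} (h : nat -> R) (n : nat) : (0 < n)%N ->
  \sum_(1 <= k < n) (h k - h k.-1) = h n.-1 - h 0%N.
Proof.
case: n => // n _; elim: n => [|n IH]; first by rewrite big_geq// subrr.
by rewrite big_nat_recr//= IH addrC subrKA.
Qed.

Section Closure.
Context {R : realType} {V : lmodType R} {Omega : Type}.
Variable Pd : (Omega -> V) -> Prop.
Hypothesis PdD : forall f g, Pd f -> Pd g -> Pd (fun w => f w + g w).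
Hypothesis PdZ : forall a f, Pd f -> Pd (fun w => a *: f w).

(** [Pd] stands both for square integrability and for strong measurability with respect to [F k].
    Index 0 may be left out of the hypothesis because its weight [2 h_0] is zero. *)
Lemma running_avg_closed (h : nat -> R) (v0 : V) (v : nat -> Omega -> V) k :
  h 0%N = 0 -> Pd (cst v0) -> (forall j, (1 <= j < k)%N -> Pd (v j)) ->
  Pd (fun w => running_avg h v0 (fun j => v j w) k).
Proof.
move=> h0 P0; elim: k => [//|k IH] Pv.
under eq_fun do rewrite running_avgS.
apply: PdZ; apply: PdD.
  by apply: IH => j /andP[j1 jk]; apply: Pv; rewrite j1 leqW.
case: k Pv {IH} => [|k] Pv; last by apply: PdZ; apply: Pv; rewrite ltnSn.
rewrite h0 mulr0; under eq_fun do rewrite scale0r -(scale0r v0).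
exact: PdZ P0.
Qed.
End Closure.

(** The conditional bound is tested on the whole space, which is an event of [G]. Square
    integrability of the noise is obtained here along with the bound. *)
Lemma cond_variance_le {d : measure_display} {Omega : measurableType d} {R : realType}
    {H : normedModType R} (P : probability Omega R) (G : set (set Omega))
    (xi : Omega -> H) (s2 : R) :
  0 <= s2 -> G `<=` measurable -> sigma_algebra [set: Omega] G ->
  strongly_measurable measurable xi ->
  (exists2 g, is_cond_expectation_ge0 P G (fun w => (`|xi w| ^+ 2)%:E) g
     & {ae P, forall w, (g w <= s2%:E)%E}) ->
  L2 P xi /\ \int[P]_w `|xi w| ^+ 2 <= s2.
Proof.
move=> s20 Gm saG mxi [g [g0 gm gint] gs].
have GT : G setT by exact: sigma_algebraT.
have mg : measurable_fun setT g.
  by move=> _ B mB; rewrite setTI; exact/Gm/gm.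
have E : (\int[P]_w (`|xi w| ^+ 2)%:E <= s2%:E)%E.
  rewrite -(gint _ GT).
  have -> : s2%:E = (\int[P]_w (cst s2%:E w))%E.
    by rewrite integral_cst// [X in (_ * X)%E](_ : _ = 1%E) ?mule1//; exact: probability_setT.
  apply: ae_ge0_le_integral => //.
  by apply: filterS gs => w h _.
have mxi2 : measurable_fun setT (fun w => `|xi w| ^+ 2).
  by apply: measurable_funX; exact: measurable_norm.
have I : @integrableR _ Omega R P (fun w => `|xi w| ^+ 2).
  apply/integrableP; split; first exact/measurable_EFinP.
  apply: (@le_lt_trans _ _ s2%:E); last by rewrite ltry.
  apply: le_trans E; rewrite le_eqVlt; apply/orP; left; apply/eqP.
  by apply: eq_integral => w _ /=; rewrite ger0_norm// sqr_ge0.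
split; first by split.
rewrite -lee_fin /Rintegral fineK//; exact: (integrable_fin_num measurableT I).
Qed.

Section PathClosure.
Context {R : realType} {V : lmodType R} {Omega : Type}.
Variable Pd : (Omega -> V) -> Prop.
Hypothesis PdD : forall f g, Pd f -> Pd g -> Pd (fun w => f w + g w).
Hypothesis PdZ : forall a f, Pd f -> Pd (fun w => a *: f w).
Variables (G : V -> V) (p : V) (h : nat -> R) (om : nat -> R) (c : R).
Variables (x z b xi : nat -> Omega -> V) (k : nat).
Hypothesis h0 : h 0%N = 0.
Hypothesis Pp : Pd (cst p).
Hypothesis Pz : forall j, (1 <= j < k)%N -> Pd (z j).
Hypothesis PG : forall j, (1 <= j < k)%N -> Pd (fun w => G (z j w)).
Hypothesis Pb : forall j, (1 <= j < k)%N -> Pd (b j).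
Hypothesis Pxi : forall j, (1 <= j < k)%N -> Pd (xi j).
Hypothesis Px : Pd (x k).

Let PdB f g : Pd f -> Pd g -> Pd (fun w => f w - g w).
Proof.
move=> Pf Pg; under eq_fun do rewrite -scaleN1r.
by apply: PdD => //; exact: PdZ.
Qed.

Let P0 : Pd (cst 0).
Proof. by have := PdZ 0 Pp; under eq_fun do rewrite scale0r. Qed.

Lemma path_zb_closed : Pd (fun w => running_avg h p (fun j => z j w) k).
Proof. exact: running_avg_closed. Qed.

Lemma path_gb_closed : Pd (fun w => running_avg h 0 (fun j => G (z j w)) k).
Proof. exact: (running_avg_closed PdD PdZ (v := fun j w => G (z j w))). Qed.

Lemma path_W_closed :
  Pd (fun w => running_avg h 0 (fun j => G (z j w) - b j w - xi j w) k).
Proof.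
apply: (running_avg_closed PdD PdZ (v := fun j w => G (z j w) - b j w - xi j w)) => // j jk.
by apply: PdB; [apply: PdB; [exact: PG|exact: Pb]|exact: Pxi].
Qed.

Lemma path_u_closed : Pd (fun w => path_u p (z^~ w) h (x^~ w) om k).
Proof. by apply: PdZ; apply: PdB => //; exact: path_zb_closed. Qed.

Lemma path_y_closed : Pd (fun w => path_y G (z^~ w) h (b^~ w) (xi^~ w) c k).
Proof. by apply: PdZ; exact: path_W_closed. Qed.

Lemma path_nu_closed : Pd (fun w => path_nu G (z^~ w) h (b^~ w) (xi^~ w) c k).
Proof. by apply: PdZ; apply: PdB; [exact: path_gb_closed|exact: path_W_closed]. Qed.

Lemma path_noise_closed : Pd (fun w => G (z k w)) -> Pd (b k) ->
  Pd (fun w => path_noise G p (z^~ w) h (x^~ w) (b^~ w) (xi^~ w) om c k).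
Proof.
move=> PGk Pbk.
have Pu := path_u_closed; have Py := path_y_closed; have Pnu := path_nu_closed.
have PD : Pd (fun w => path_D G (z^~ w) h c k).
  by apply: PdZ; apply: PdB => //; exact: path_gb_closed.
have Pbb : Pd (fun w => (c / 2) *: b k w) by exact: PdZ.
rewrite /path_noise /step_noise.
apply: PdD; last by apply: PdZ; apply: PdD; exact: PdZ.
apply: PdD; last first.
  by apply: PdZ; apply: PdD; apply: PdZ => //; apply: PdD => //; exact: PdZ.
apply: PdB; last by apply: PdZ; apply: PdB => //; exact: PdZ.
apply: PdB; last by apply: PdZ; apply: PdD => //; exact: PdZ.
by apply: PdZ; apply: PdD => //; exact: PdB.
Qed.

End PathClosure.

Lemma sum_sqr_le {R : realDomainType} (x y z : R) :
  0 <= x -> 0 <= y -> 0 <= z -> x ^+ 2 + z ^+ 2 + y ^+ 2 <= (x + (y + z)) ^+ 2.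
Proof.
move=> x0 y0 z0; have := mulr_ge0 x0 y0; have := mulr_ge0 x0 z0; have := mulr_ge0 y0 z0.
by lra.
Qed.

(** * Integration of the energy inequality and the bound at time [K] *)

Section LastIterates.
Context {R : realType} {H : completeNormedModType R} (dot : {dot H for (@idfun R)}).
Hypothesis norm_dot : forall h : H, `|h| ^+ 2 = dot h h.
Variable T : H -> H.
Hypothesis nT : nonexpansive T.
Variables (K : nat) (a : R).
Hypothesis K_ge2 : (2 <= K)%N.
Hypothesis a_gt0 : 0 < a.
Hypothesis a_le : a <= K%:R * ln 2 / ln K%:R - 1.
Context {d : measure_display} {Omega : measurableType d}.
Variable (P : probability Omega R).
Variables (F : nat -> set (set Omega)) (That : nat -> Omega -> H -> H).
Variables (x y z b xi : nat -> Omega -> H) (x0 x1 : H).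
Hypotheses (x_0 : x 0%N = cst x0) (x_1 : x 1%N = cst x1).
Variable sigma : R.
Hypothesis sigma_ge0 : 0 <= sigma.
Hypothesis iKM : stochastic_iKM K (sp_alpha K a) (sp_beta K a) (sp_lambda K a)
             That x y z.
Hypothesis oracle : stochastic_oracle P K F T That x y z b xi sigma.
Hypothesis B_fin : (rms_bias P K b < +oo)%E.

Let F_sa k : (1 <= k <= K)%N -> sigma_algebra [set: Omega] (F k).
Proof. by move=> kK; have [] := oracle_sigma_algebra oracle kK. Qed.
Let F_meas k : (1 <= k <= K)%N -> F k `<=` measurable.
Proof. by move=> kK; have [] := oracle_sigma_algebra oracle kK. Qed.

Let F_mono j k : (1 <= j)%N -> (j <= k <= K)%N -> F j `<=` F k.
Proof.
move=> j1; elim: k => [|k IH] /andP[jk kK].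
  by move: (leq_trans j1 jk).
move: jk; rewrite leq_eqVlt => /orP[/eqP -> //|jk].
have k1 : (1 <= k)%N by exact: leq_trans j1 _.
have jk' : (j <= k)%N by rewrite -ltnS.
apply: (subset_trans (IH _)); first by rewrite jk' ltnW.
by apply: (oracle_filtration oracle); rewrite k1.
Qed.

Lemma L2_noise k : (1 <= k <= K)%N ->
  L2 P (xi k) /\ \int[P]_w `|xi k w| ^+ 2 <= sigma ^+ 2.
Proof.
move=> kK; have [_ [_ mxi _]] := oracle_measurable oracle kK.
apply: (cond_variance_le _ (F_meas kK) (F_sa kK) mxi); first exact: sqr_ge0.
exact: (oracle_noise_variance oracle kK).
Qed.

Lemma L2_bias k : (1 <= k < K)%N -> L2 P (b k).
Proof.
move=> /[dup] kK /andP[k1 k2].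
have [_ [mb _ _]] := oracle_measurable oracle (ltac:(by rewrite k1 ltnW) : (1 <= k <= K)%N).
apply: L2_rms => //; apply: le_lt_trans B_fin.
rewrite /rms_bias (bigD1_seq k) ?mem_index_iota ?iota_uniq//=.
by rewrite leeDl// sume_ge0// => i _; exact: sqrte_ge0.
Qed.

Let L2yz k : (1 <= k <= K)%N -> L2 P (x k.-1) -> L2 P (x k) ->
  L2 P (y k) /\ L2 P (z k).
Proof.
move=> kK Lx' Lx.
have Lxx := L2B norm_dot Lx Lx'.
split.
  rewrite (_ : y k = fun w => x k w + sp_alpha K a k *: (x k w - x k.-1 w)).
    by apply: (L2D norm_dot) => //; exact: L2Z.
  by apply/funext => w; have [] := iKM w kK.
rewrite (_ : z k = fun w => x k w + sp_beta K a k *: (x k w - x k.-1 w)).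
  by apply: (L2D norm_dot) => //; exact: L2Z.
by apply/funext => w; have [] := iKM w kK.
Qed.

(** The last iterate involves the biases only up to index [K - 1], which is exactly the range
    controlled by [B_fin]. *)
Lemma L2_iterates k : (1 <= k <= K)%N -> L2 P (x k.-1) /\ L2 P (x k).
Proof.
elim: k => [//|[|k] IH] kK.
  by rewrite /= x_0 x_1; split; exact: L2_cst.
have kK' : (1 <= k.+1 <= K)%N by move: kK => /= /ltnW.
have [Lx' Lx] := IH kK'; split => //; have [Ly Lz] := L2yz kK' Lx' Lx.
have [Lxi _] := L2_noise kK'; have Lb : L2 P (b k.+1) by apply: L2_bias; move: kK => /= ->.
rewrite (_ : x k.+2 = fun w => (1 - sp_lambda K a k.+1) *: y k.+1 w
    + sp_lambda K a k.+1 *: (T (z k.+1 w) + b k.+1 w + xi k.+1 w)).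
  apply: (L2D norm_dot); first exact: L2Z.
  apply: L2Z; apply: (L2D norm_dot) => //; apply: (L2D norm_dot) => //.
  exact: (L2_nonexp norm_dot).
by apply/funext => w; have [_ _ ->] := iKM w kK'; rewrite (oracle_eq oracle).
Qed.

Let L2z k : (1 <= k <= K)%N -> L2 P (z k).
Proof. by move=> kK; have [Lx' Lx] := L2_iterates kK; have [] := L2yz kK Lx' Lx. Qed.
Let L2y k : (1 <= k <= K)%N -> L2 P (y k).
Proof. by move=> kK; have [Lx' Lx] := L2_iterates kK; have [] := L2yz kK Lx' Lx. Qed.

Let G (v : H) := v - T v.

Let L2G k : (1 <= k <= K)%N -> L2 P (fun w => G (z k w)).
Proof.
by move=> kK; apply: (L2B norm_dot); [exact: L2z|exact: (L2_nonexp norm_dot _ (L2z kK))].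
Qed.

Variable p : H.
Hypothesis Tp : T p = p.

Let Gp : G p = 0. Proof. by rewrite /G Tp subrr. Qed.
Let G_coco u v : 0 <= coco_gap dot (G u - G v) (u - v).
Proof.
rewrite /coco_gap; have -> : G u - G v = (u - v) - (T u - T v).
  by rewrite /G !opprB [T v - v]addrC addrACA [- T u + T v]addrC.
have := nT u v; move: (u - v) (T u - T v) => f g fg.
have : `|g| ^+ 2 <= `|f| ^+ 2 by rewrite lerXn2r ?nnegrE.
rewrite !norm_dot -(scaleN1r g) !(dotDl dot) !(dotDr dot) !(dotZl dot) !(dotZr dot) (dotC dot g f); lra.
Qed.

Local Notation h := (sp_h K a).
Local Notation om := (sp_omega K a).
Local Notation c := (sp_c K a).
Let V k w := path_energy dot G p (z^~ w) h (x^~ w) (b^~ w) (xi^~ w) om c k.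
Let Th k w := (c / 2) *: path_noise G p (z^~ w) h (x^~ w) (b^~ w) (xi^~ w) om c k.

Let h_ge0 := sp_h_ge0 K_ge2 a_gt0.
Let h_le1 := sp_h_le1 K_ge2 a_gt0 a_le.
Let h0 := sp_h0 a K_ge2.
Let om_gt0 := sp_omega_gt0 a K_ge2.
Let c_gt0 := sp_c_gt0 K_ge2 a_gt0.

Let iKMp w k : (1 <= k <= K)%N ->
  [/\ y k w = x k w + sp_alpha K a k *: (x k w - x k.-1 w),
      z k w = x k w + sp_beta K a k *: (x k w - x k.-1 w)
    & x k.+1 w = (1 - sp_lambda K a k) *: y k w
       + sp_lambda K a k *: (z k w - (G (z k w) - b k w - xi k w))].
Proof.
move=> kK; have [yE zE xE] := iKM w kK; split => //.
rewrite xE (oracle_eq oracle)// /G; congr (_ + _ *: _).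
by rewrite !opprD !opprK !addrA subrr add0r.
Qed.

Let V_step w k (tau : R) : (1 <= k < K)%N -> 0 < tau -> tau <= 1 ->
  V k.+1 w <= (1 + 44 * (h k - h k.-1) + 2 * tau) * V k w
    + 10 ^+ 6 * (h k ^+ 2 / tau) * ((c / 2) ^+ 2 * dot (b k w) (b k w))
    + 2000 * h k ^+ 2 * ((c / 2) ^+ 2 * dot (xi k w) (xi k w))
    + dot (xi k w) (Th k w).
Proof.
move=> /andP[k1 kK] t0 t1.
have kK' : (1 <= k <= K)%N by rewrite k1 ltnW.
apply: (path_energyS (dotC dot) (dotDl dot) (dotZl dot) (dot_ge0 norm_dot)
  (@dot_eq0 _ _ _ norm_dot) Gp G_coco h_ge0 om_gt0 c_gt0 (sp_omegaE a K_ge2)) => //.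
- exact: (iKM_x (x := x^~ w) (y := y^~ w) (z := z^~ w)
    (gam := fun k => G (z k w) - b k w - xi k w) K_ge2 a_gt0 a_le (iKMp w) kK').
- exact: (iKM_z (x := x^~ w) (y := y^~ w) (z := z^~ w)
    (gam := fun k => G (z k w) - b k w - xi k w) K_ge2 a_gt0 a_le (iKMp w) kK').
- exact: sp_h_mono.
- exact: sp_small.
Qed.

Let L2_path k : (1 <= k <= K)%N ->
  [/\ L2 P (fun w => path_u p (z^~ w) h (x^~ w) om k),
      L2 P (fun w => path_y G (z^~ w) h (b^~ w) (xi^~ w) c k),
      L2 P (fun w => path_nu G (z^~ w) h (b^~ w) (xi^~ w) c k),
      L2 P (fun w => running_avg h p (fun j => z j w) k)
    & L2 P (fun w => running_avg h 0 (fun j => G (z j w)) k)].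
Proof.
move=> /andP[k1 kK].
have le j : (1 <= j < k)%N -> (1 <= j <= K)%N.
  by move=> /andP[-> jk]; exact: leq_trans (ltnW jk) kK.
have lt j : (1 <= j < k)%N -> (1 <= j < K)%N.
  by move=> /andP[-> jk]; exact: leq_trans jk kK.
have Lz j : (1 <= j < k)%N -> L2 P (z j) by move=> /le; exact: L2z.
have LG j : (1 <= j < k)%N -> L2 P (fun w => G (z j w)) by move=> /le; exact: L2G.
have Lb j : (1 <= j < k)%N -> L2 P (b j) by move=> /lt; exact: L2_bias.
have Lxi j : (1 <= j < k)%N -> L2 P (xi j) by move=> /le /L2_noise[].
have Lx : L2 P (x k) by have [] := L2_iterates (ltac:(by rewrite k1) : (1 <= k <= K)%N).
have LD := @L2D _ _ _ _ dot norm_dot P; have LZ := @L2Z _ Omega R H P.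
split.
- exact: path_u_closed (L2_cst P p) _ _.
- exact: (path_y_closed LD LZ c h0 (L2_cst P p) LG Lb Lxi).
- exact: (path_nu_closed LD LZ c h0 (L2_cst P p) LG Lb Lxi).
- exact: (path_zb_closed LD LZ h0 (L2_cst P p) Lz).
- exact: (path_gb_closed LD LZ h0 (L2_cst P p) LG).
Qed.

Let Th_meas k : (1 <= k < K)%N -> strongly_measurable (F k) (Th k) /\ L2 P (Th k).
Proof.
move=> /[dup] kK /andP[k1 k2]; have kK' : (1 <= k <= K)%N by rewrite k1 ltnW.
have le j : (1 <= j < k)%N -> (1 <= j <= K)%N.
  by move=> /andP[-> jk]; exact: ltnW (ltn_trans jk k2).
have lt j : (1 <= j < k)%N -> (1 <= j < K)%N.
  by move=> /andP[-> jk]; exact: ltn_trans jk k2.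
have sub j : (1 <= j < k)%N -> F j `<=` F k.
  by move=> /andP[j1 jk]; apply: F_mono => //; rewrite (ltnW jk) ltnW.
(* The noise [xi j] is known one step later than the other variables of index [j]; as only [j < k]
   enter the averages at time [k], this is still early enough. *)
have subS j : (1 <= j < k)%N -> F j.+1 `<=` F k.
  by move=> /andP[j1 jk]; apply: F_mono => //; rewrite jk ltnW.
have sa := F_sa kK'.
have [_ Fx _ Fz Fb] := oracle_adapted oracle kK.
have FG j : (1 <= j < K)%N -> strongly_measurable (F j) (fun w => G (z j w)).
  move=> jK; have [_ _ _ Fzj _] := oracle_adapted oracle jK.
  have saj : sigma_algebra [set: Omega] (F j).
    by apply: F_sa; move: jK => /andP[-> /ltnW].
  by apply: (strongly_measurableB saj) => //; exact: (strongly_measurable_nonexp saj nT).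
split.
  apply: strongly_measurableZ => //.
  have SD := @strongly_measurableD _ Omega R (F k) sa H.
  have SZ := @strongly_measurableZ _ Omega R (F k) sa H.
  apply: (path_noise_closed SD SZ om c h0 (strongly_measurable_cst sa p)) => //.
  - move=> j jk; have [_ _ _ Fzj _] := oracle_adapted oracle (lt j jk).
    exact: strongly_measurableS (sub j jk) Fzj.
  - by move=> j jk; exact: strongly_measurableS (sub j jk) (FG j (lt j jk)).
  - move=> j jk; have [_ _ _ _ Fbj] := oracle_adapted oracle (lt j jk).
    exact: strongly_measurableS (sub j jk) Fbj.
  - move=> j jk; have [Fxij _] := oracle_noise_adapted oracle (lt j jk).
    exact: strongly_measurableS (subS j jk) Fxij.
  - exact: FG.
apply: L2Z.
have LD := @L2D _ _ _ _ dot norm_dot P; have LZ := @L2Z _ Omega R H P.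
apply: (path_noise_closed LD LZ om c h0 (L2_cst P p)) => //.
- by move=> j /le; exact: L2z.
- by move=> j /le; exact: L2G.
- by move=> j /lt; exact: L2_bias.
- by move=> j /le /L2_noise[].
- by have [] := L2_iterates kK'.
- exact: L2G.
- exact: L2_bias.
Qed.

Local Notation IntR := (@integrableR _ Omega R P).
Local Notation disp k w := (dispersion dot G p (z^~ w) h k).

Let int_gap (f g : Omega -> H) : L2 P f -> L2 P g -> IntR (fun w => coco_gap dot (f w) (g w)).
Proof.
move=> Lf Lg; apply: integrableRB; first exact: (integrable_dot norm_dot).
under eq_fun do rewrite mulrC; apply: integrableRZ; exact: (integrable_dot norm_dot).
Qed.

Let int_disp k : (1 <= k <= K)%N -> IntR (fun w => disp k w).
Proof.
elim: k => // k IH kK; under eq_fun do rewrite dispersionS.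
apply: integrableRZ; case: k IH kK => [|k] IH kK.
  (* Nothing is known about [z 0]; the zero weight [h 0] removes it. *)
  under eq_fun do rewrite h0 mulr0 mul0r mul0r addr0.
  exact: (integrableR_cst P 0).
have kK' : (1 <= k.+1 <= K)%N by move: kK => /= /ltnW.
apply: integrableRD; first exact: IH.
apply: integrableRZ; have [_ _ _ Lzb Lgb] := L2_path kK'.
apply: int_gap; apply: (L2B norm_dot) => //; [exact: L2G|exact: L2z].
Qed.

Let int_V k : (1 <= k <= K)%N -> IntR (V k).
Proof.
move=> kK; have [Lu Ly Lnu _ _] := L2_path kK; have Id := int_disp kK.
have LL (r : R) : L2 P (fun w => path_u p (z^~ w) h (x^~ w) om k
    + r *: path_y G (z^~ w) h (b^~ w) (xi^~ w) c k).
  by apply: (L2D norm_dot) => //; exact: L2Z.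
have ID := integrable_dot norm_dot.
apply: integrableRD; last by apply: integrableRZ; exact: ID.
apply: integrableRB; last first.
  apply: integrableRZ; apply: ID => //; apply: (L2B norm_dot) => //; exact: L2Z.
apply: integrableRD.
  by apply: integrableRD; [exact: ID|apply: integrableRZ; exact: ID].
apply: integrableRZ.
rewrite (_ : (fun w => _) = fun w => (c / om k.-1) * disp k w); first exact: integrableRZ.
by apply/funext => w; rewrite /path_d mulrAC.
Qed.

Let EV k := \int[P]_w V k w.
Let nb k := Num.sqrt (\int[P]_w `|b k w| ^+ 2).

Let nb_sq k : nb k ^+ 2 = \int[P]_w `|b k w| ^+ 2.
Proof. by rewrite sqr_sqrtr// Rintegral_ge0// => w _; exact: sqr_ge0. Qed.

Let EV_step k (tau : R) : (1 <= k < K)%N -> 0 < tau -> tau <= 1 ->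
  EV k.+1 <= (1 + (44 * (h k - h k.-1) + 2 * tau)) * EV k
    + (10 ^+ 6 * (h k ^+ 2 / tau) * ((c / 2) ^+ 2 * nb k ^+ 2)
      + 2000 * h k ^+ 2 * ((c / 2) ^+ 2 * sigma ^+ 2)).
Proof.
move=> /[dup] kK /andP[k1 k2] t0 t1.
have kK' : (1 <= k <= K)%N by rewrite k1 ltnW.
have Lb := L2_bias kK; have [Lxi sxi] := L2_noise kK'.
have [FTh LTh] := Th_meas kK.
have IVk := int_V kK'.
have Ib : IntR (fun w => dot (b k w) (b k w)) by exact: integrable_dot.
have Ixi : IntR (fun w => dot (xi k w) (xi k w)) by exact: integrable_dot.
have ITh : IntR (fun w => dot (xi k w) (Th k w)) by exact: integrable_dot.
have I1 := integrableRZ (1 + 44 * (h k - h k.-1) + 2 * tau) IVk.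
have I2 := integrableRZ (10 ^+ 6 * (h k ^+ 2 / tau)) (integrableRZ ((c / 2) ^+ 2) Ib).
have I3 := integrableRZ (2000 * h k ^+ 2) (integrableRZ ((c / 2) ^+ 2) Ixi).
have IVS : IntR (V k.+1) by apply: int_V.
have := le_Rintegral measurableT IVS
  (integrableRD (integrableRD (integrableRD I1 I2) I3) ITh)
  (fun w _ => V_step w kK t0 t1).
rewrite RintegralD//; last exact: (integrableRD (integrableRD I1 I2) I3).
rewrite RintegralD//; last exact: (integrableRD I1 I2).
rewrite RintegralD// !RintegralZl//; try exact: integrableRZ.
rewrite (cond_mean_zero norm_dot (F_sa kK') (F_meas kK')
  (oracle_noise_mean oracle kK') Lxi FTh LTh) addr0.
have -> : \int[P]_w dot (b k w) (b k w) = nb k ^+ 2.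
  by rewrite nb_sq; apply: eq_Rintegral => w _; rewrite norm_dot.
move=> /le_trans; apply; rewrite -!addrA lerD// lerD2l.
apply: ler_wpM2l; first by apply: mulr_ge0; [exact: ler0n|exact: sqr_ge0].
apply: ler_wpM2l; first exact: sqr_ge0.
by under eq_Rintegral do rewrite -norm_dot.
Qed.

Let V1 w : V 1%N w = `|x1 - p| ^+ 2 / om 0%N ^+ 2.
Proof.
have W1 (v0 : H) (v : nat -> H) : running_avg h v0 v 1 = v0.
  by rewrite running_avgS running_avg0 h0 mulr0 scale0r !addr0 invr1 scale1r.
have d1 : disp 1 w = 0 by rewrite dispersionS h0 !(mulr0, mul0r, addr0).
have y1 : path_y G (z^~ w) h (b^~ w) (xi^~ w) c 1 = 0 by rewrite /path_y W1 scaler0.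
have nu1 : path_nu G (z^~ w) h (b^~ w) (xi^~ w) c 1 = 0.
  by rewrite /path_nu !W1 subr0 scaler0.
have u1 : path_u p (z^~ w) h (x^~ w) om 1 = (om 0%N)^-1 *: (p - x1).
  by rewrite /path_u W1 x_1.
have pd1 : path_d dot G p (z^~ w) h om c 1 = 0 by rewrite /path_d d1 mulr0 mul0r.
rewrite /V /path_energy y1 nu1 u1 pd1 /energy !scaler0 addr0.
have d0 (v : H) : dot 0 v = 0 by rewrite -(scale0r 0) (dotZl dot) mul0r.
rewrite !d0 !(mulr0, addr0, subr0) -norm_dot.
by rewrite normrZ exprMn normfV gtr0_norm ?om_gt0// exprVn mulrC distrC.
Qed.

Let l := sp_step K a.
Let Bs := \sum_(1 <= k < K) nb k.

Let nb_ge0 k : 0 <= nb k. Proof. exact: sqrtr_ge0. Qed.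
Let K0 : 0 < K%:R :> R. Proof. by rewrite ltr0n (leq_trans _ K_ge2). Qed.
Let K_gt0 : (0 < K)%N. Proof. by rewrite (leq_trans _ K_ge2). Qed.

(** Gronwall, with exponent at most [44 (h_(K-1) - h_0) + 2 sum tau <= 46]. The factors
    [h_k^2 <= 4 l^2] combine with [(c / 2)^2] to [c^2 l^2]. *)
Let EV_bound : EV K <= expR 46 *
  (`|x1 - p| ^+ 2 / om 0%N ^+ 2
   + c ^+ 2 * l ^+ 2 * (2 * 10 ^+ 6 * Bs ^+ 2 + 2000 * (K%:R * sigma ^+ 2))).
Proof.
have Bs0 : 0 <= Bs by apply: sumr_ge0.
(* The shift [s] keeps the weights [tau] positive where a bias vanishes. The mean bias [Bs / K] only
   doubles the bound; if all biases vanish, any positive shift works. *)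
have [s s0 sB] : exists2 s, 0 < s & Bs * (Bs + K%:R * s) <= 2 * Bs ^+ 2.
  have [->|Bn] := eqVneq Bs 0; first by exists 1; rewrite // !mul0r expr0n /= mulr0.
  exists (Bs / K%:R); first by rewrite divr_gt0// lt_neqAle eq_sym Bn.
  rewrite le_eqVlt; apply/orP; left; apply/eqP.
  by rewrite mulrCA divff ?gt_eqF// mulr1; ring.
have D0 : 0 < Bs + K%:R * s by rewrite ltr_wpDl// mulr_gt0.
(* The sum of the weights is at most 1, while [nb k ^+ 2 / tau k <= nb k * (Bs + K s)]; the bias
   terms thus add up to a multiple of [Bs ^+ 2]. *)
pose tau k := (nb k + s) / (Bs + K%:R * s).
have tau0 k : 0 < tau k by rewrite divr_gt0// ltr_wpDl.
have tau1 k : (1 <= k < K)%N -> tau k <= 1.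
  move=> kK; rewrite ler_pdivrMr// mul1r lerD//.
    rewrite /Bs (bigD1_seq k) ?mem_index_iota ?iota_uniq//= lerDl.
    by apply: sumr_ge0.
  by rewrite ler_peMl ?(ltW s0)// ler1n.
have stau : \sum_(1 <= k < K) tau k <= 1.
  rewrite -mulr_suml ler_pdivrMr// mul1r big_split/= lerD2l.
  rewrite sumr_const_nat -[leLHS]mulr_natl ler_wpM2r ?(ltW s0)// ler_nat.
  exact: leq_subr.
pose e k := 44 * (h k - h k.-1) + 2 * tau k.
pose f k := 10 ^+ 6 * (h k ^+ 2 / tau k) * ((c / 2) ^+ 2 * nb k ^+ 2)
      + 2000 * h k ^+ 2 * ((c / 2) ^+ 2 * sigma ^+ 2).
have M6 : 0 <= 10 ^+ 6 :> R by apply: exprn_ge0; exact: ler0n.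
have f0 k : 0 <= f k.
  apply: addr_ge0; apply: mulr_ge0; try (by apply: mulr_ge0; exact: sqr_ge0).
    by apply: mulr_ge0 M6 _; apply: divr_ge0; [exact: sqr_ge0|exact/ltW].
  by apply: mulr_ge0; [exact: ler0n|exact: sqr_ge0].
have e0 k : 0 <= e k.
  apply: addr_ge0; apply: mulr_ge0; rewrite ?ler0n ?(ltW (tau0 k))//.
  by rewrite subr_ge0 sp_h_mono.
have EV1 : EV 1%N = `|x1 - p| ^+ 2 / om 0%N ^+ 2.
  rewrite /EV; under eq_Rintegral do rewrite V1.
  have -> : fine (P [set: Omega]) = 1 -> \int[P]_w (`|x1 - p| ^+ 2 / om 0%N ^+ 2) = `|x1 - p| ^+ 2 / om 0%N ^+ 2.
    by move=> P1; rewrite Rintegral_cst// [X in _ * X]P1 mulr1.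
  - by [].
  - by rewrite (_ : P [set: Omega] = 1%E)//; exact: probability_setT.
have := discrete_gronwall (v := EV) (e := e) (f := f) K_gt0 (fun k _ => e0 k) (fun k _ => f0 k)
  (fun k kK => EV_step kK (tau0 k) (tau1 k kK)).
rewrite EV1 => /(_ (divr_ge0 (sqr_ge0 _) (sqr_ge0 _))) /le_trans; apply.
have Q0 : 0 <= `|x1 - p| ^+ 2 / om 0%N ^+ 2 by rewrite divr_ge0 ?sqr_ge0.
apply: ler_pM; rewrite ?expR_ge0//.
- by apply: addr_ge0 => //; apply: sumr_ge0.
- rewrite ler_expR big_split/= -!mulr_sumr sum_increments// h0 subr0.
  have := h_le1 K.-1; move: stau; lra.
rewrite lerD2l.
have l0 := sp_step_gt0 K_ge2 a_gt0.
have fle k : f k <= c ^+ 2 * l ^+ 2 * (10 ^+ 6 * (nb k * (Bs + K%:R * s)) + 2000 * sigma ^+ 2).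
  have hl2 : h k ^+ 2 <= 4 * l ^+ 2.
    have -> : 4 * l ^+ 2 = (2 * l) ^+ 2 by ring.
    rewrite lerXn2r ?nnegrE ?h_ge0//; first by apply: mulr_ge0; [exact: ler0n|exact: ltW].
    exact: sp_h_le_step.
  have nt : nb k ^+ 2 / tau k <= nb k * (Bs + K%:R * s).
    rewrite /tau invf_div mulrCA mulrC ler_wpM2r ?(ltW D0)//.
    rewrite ler_pdivrMr ?ltr_wpDl// expr2 ler_wpM2l// lerDl ltW//.
  have a1 : h k ^+ 2 * (nb k ^+ 2 / tau k) <= 4 * l ^+ 2 * (nb k * (Bs + K%:R * s)).
    by apply: ler_pM => //; [exact: sqr_ge0|apply: divr_ge0; [exact: sqr_ge0|exact/ltW]].
  have a2 : h k ^+ 2 * sigma ^+ 2 <= 4 * l ^+ 2 * sigma ^+ 2 by rewrite ler_wpM2r// sqr_ge0.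
  have cc : 0 <= (c / 2) ^+ 2 by exact: sqr_ge0.
  have b1 := ler_wpM2l cc a1; have b2 := ler_wpM2l cc a2.
  have b3 := ler_wpM2l M6 b1.
  rewrite (_ : f k = 10 ^+ 6 * ((c / 2) ^+ 2 * (h k ^+ 2 * (nb k ^+ 2 / tau k)))
    + 2000 * ((c / 2) ^+ 2 * (h k ^+ 2 * sigma ^+ 2))); last by rewrite /f; ring.
  rewrite (_ : c ^+ 2 * l ^+ 2 * _ = 10 ^+ 6 * ((c / 2) ^+ 2 * (4 * l ^+ 2 * (nb k * (Bs + K%:R * s))))
    + 2000 * ((c / 2) ^+ 2 * (4 * l ^+ 2 * sigma ^+ 2))); last by field.
  by apply: (lerD b3); apply: (ler_wpM2l _ b2); exact: ler0n.
apply: (le_trans (ler_sum _ (fun k _ => fle k))).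
rewrite -mulr_sumr; apply: ler_wpM2l; first by apply: mulr_ge0; exact: sqr_ge0.
rewrite big_split/= -mulr_sumr -mulr_suml -/Bs; apply: lerD.
  rewrite (_ : 2 * 10 ^+ 6 * Bs ^+ 2 = 10 ^+ 6 * (2 * Bs ^+ 2)); last by ring.
  exact: (ler_wpM2l M6 sB).
rewrite sumr_const_nat.
have -> : (2000 * sigma ^+ 2) *+ (K - 1) = 2000 * ((K - 1)%:R * sigma ^+ 2).
  by rewrite (mulr_natl (sigma ^+ 2) (K - 1)) mulrnAr.
apply: ler_wpM2l; first exact: ler0n.
by apply: ler_wpM2r; [exact: sqr_ge0|rewrite ler_nat leq_subr].
Qed.

Let W k w := running_avg h 0 (fun j => G (z j w) - b j w - xi j w) k.

Lemma residual_rms (v : Omega -> H) : L2 P v ->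
  (forall w, exists2 s, `|s| <= 2 & v w - z K w = (s * (c * om K.-1)) *: W K w) ->
  (rms P (fun w => v w - T (v w))%R <=
   (Num.sqrt (1000 * expR 46 * (2 * 10 ^+ 6)) *
    ((1 + a^-1) / K%:R * `|x1 - p| +
     (1 + a) * (sigma * ln K%:R / Num.sqrt K%:R + Bs * (ln K%:R / K%:R))))%:E)%E.
Proof.
move=> Lv vE; have KK : (1 <= K <= K)%N by rewrite K_gt0 leqnn.
have Lr : L2 P (fun w => v w - T (v w)).
  by apply: (L2B norm_dot) => //; exact: (L2_nonexp norm_dot).
rewrite (rms_sqr Lr) lee_fin.
have pw w : `|v w - T (v w)| ^+ 2 <= 1000 / c ^+ 2 * V K w.
  rewrite norm_dot; have [s s2 sE] := vE w.
  apply: (residual_le (dotC dot) (dotDl dot) (dotZl dot) (dot_ge0 norm_dot)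
    (@dot_eq0 _ _ _ norm_dot) Gp G_coco h_ge0 om_gt0 c_gt0 (h_le1 _)
    (sp_c_omega_last K_ge2 a_gt0 a_le) (s := s)) => //.
  exact: (iKM_z (x := x^~ w) (y := y^~ w) (z := z^~ w)
    (gam := fun k => G (z k w) - b k w - xi k w) K_ge2 a_gt0 a_le (iKMp w) KK).
have I2 : \int[P]_w `|v w - T (v w)| ^+ 2 <= 1000 / c ^+ 2 * EV K.
  rewrite -RintegralZl//; last exact: int_V.
  apply: le_Rintegral => //; first by have [] := Lr.
  by apply: integrableRZ; exact: int_V.
have c2 : 0 < c ^+ 2 by rewrite exprn_gt0// c_gt0.
have l0 := sp_step_gt0 K_ge2 a_gt0.
have M0 : 0 <= 1000 * expR 46 :> R by apply: mulr_ge0; [exact: ler0n|exact: expR_ge0].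
have M6 : 0 <= 10 ^+ 6 :> R by apply: exprn_ge0; exact: ler0n.
have M1 : 16 <= 2 * 10 ^+ 6 :> R by lra.
have M2 : 2000 <= 2 * 10 ^+ 6 :> R by lra.
have ai : 0 < a^-1 by rewrite invr_gt0.
have Bs0 : 0 <= Bs by apply: sumr_ge0.
set X := (1 + a^-1) / K%:R * _; pose Y := l * (Num.sqrt K%:R * sigma).
pose Z := l * Bs.
have sK : Num.sqrt K%:R ^+ 2 = K%:R :> R by rewrite sqr_sqrtr ?ler0n.
have sK0 : 0 < Num.sqrt K%:R :> R by rewrite sqrtr_gt0.
have -> : (1 + a) * (sigma * ln K%:R / Num.sqrt K%:R + Bs * (ln K%:R / K%:R)) = Y + Z.
  rewrite /Y /Z /l /sp_step; move: (Num.sqrt K%:R) sK sK0 => s <- s0.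
  by field; rewrite gt_eqF.
have X0 : 0 <= X.
  by apply: mulr_ge0 => //; apply: divr_ge0; [apply: addr_ge0 => //; exact: ltW|exact: ltW].
have Y0 : 0 <= Y by apply: mulr_ge0; [exact: ltW|apply: mulr_ge0 => //; exact: ltW].
have Z0 : 0 <= Z by apply: mulr_ge0 => //; exact: ltW.
have key : 1000 / c ^+ 2 * EV K <= 1000 * expR 46 * (2 * 10 ^+ 6) * (X + (Y + Z)) ^+ 2.
  have t0 : 0 <= 1000 / c ^+ 2 by apply: divr_ge0; [exact: ler0n|exact: ltW].
  apply: (le_trans (ler_wpM2l t0 EV_bound)).
  (* The factor [om 0] hidden in [c] cancels the one in the initial energy, so the distance term
     keeps just [(1 + 1/a) / K]. *)
  have cX : `|x1 - p| ^+ 2 / om 0%N ^+ 2 = c ^+ 2 * (16 * X ^+ 2).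
    rewrite /X /sp_c; move: (om_gt0 0%N) => o0.
    field; rewrite !gt_eqF//= (_ : a + 1 = 1 + a) ?gt_eqF ?addr_gt0//; by rewrite addrC.
  have cY : l ^+ 2 * (K%:R * sigma ^+ 2) = Y ^+ 2 by rewrite /Y -[X in X * sigma ^+ 2]sK; ring.
  have cZ : l ^+ 2 * Bs ^+ 2 = Z ^+ 2 by rewrite /Z; ring.
  rewrite (_ : 1000 / c ^+ 2 * _ = 1000 * expR 46 *
     (16 * X ^+ 2 + 2 * 10 ^+ 6 * Z ^+ 2 + 2000 * Y ^+ 2)); last first.
    rewrite cX -cY -cZ; field; by rewrite gt_eqF// c_gt0.
  rewrite -[leRHS]mulrA; apply: (ler_wpM2l M0).
  (* All three coefficients are at most [2 * 10^6], and for nonnegative numbers a sum of squares is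
     at most the square of the sum. *)
  have sq := sum_sqr_le X0 Y0 Z0.
  have M3 : 0 <= 2 * 10 ^+ 6 :> R by apply: mulr_ge0 M6; exact: ler0n.
  apply: (le_trans _ (ler_wpM2l M3 sq)); rewrite !mulrDr.
  apply: lerD; first apply: lerD.
  - by apply: ler_wpM2r; [exact: sqr_ge0|exact: M1].
  - exact: lexx.
  - by apply: ler_wpM2r; [exact: sqr_ge0|exact: M2].
have S0 : 0 <= X + (Y + Z) by apply: addr_ge0 => //; exact: addr_ge0.
rewrite -[X in _ <= _ * X](ger0_norm S0) -sqrtr_sqr -sqrtrM; last first.
  by apply: mulr_ge0 M0 _; apply: mulr_ge0 M6; exact: ler0n.
by apply: ler_wsqrtr; exact: le_trans I2 key.
Qed.

Lemma residual_last (v : Omega -> H) : [\/ v = x K, v = y K | v = z K] ->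
  L2 P v /\
  (rms P (fun w => v w - T (v w))%R <=
   (Num.sqrt (1000 * expR 46 * (2 * 10 ^+ 6)) *
    ((1 + a^-1) / K%:R * `|x1 - p| +
     (1 + a) * (sigma * ln K%:R / Num.sqrt K%:R + Bs * (ln K%:R / K%:R))))%:E)%E.
Proof.
have KK : (1 <= K <= K)%N by rewrite K_gt0 leqnn.
have [_ Lx] := L2_iterates KK; have Ly := L2y KK; have Lz := L2z KK.
case=> ->; (split; first by []); apply: residual_rms => // w.
- exists 1; first by rewrite normr1 ler1n.
  exact: (iKM_xz (x := x^~ w) (y := y^~ w) (z := z^~ w)
    (gam := fun k => G (z k w) - b k w - xi k w) K_ge2 a_gt0 a_le (iKMp w) KK).
- exact: (iKM_yz (x := x^~ w) (y := y^~ w) (z := z^~ w)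
    (gam := fun k => G (z k w) - b k w - xi k w) K_ge2 a_gt0 a_le (iKMp w) KK).
- by exists 0; [rewrite normr0 ler0n|rewrite subrr mul0r scale0r].
Qed.

Lemma rms_biasE : rms_bias P K b = Bs%:E.
Proof.
rewrite /rms_bias /Bs -sumEFin; apply: eq_big_nat => k kK.
by rewrite rms_sqr//; exact: L2_bias.
Qed.

End LastIterates.

Theorem theorem1 (R : realType) :
  exists C : R, 0 < C /\
  forall (H : completeNormedModType R) (dot : {dot H for (@idfun R)})
    (norm_dot : forall h : H, `|h| ^+ 2 = dot h h)
    (T : H -> H) (T_nonexpansive : nonexpansive T) (FixT0 : Fix T !=set0)
    (K : nat) (K_ge2 : (2 <= K)%N)
    (a : R) (a_gt0 : 0 < a) (a_le : a <= K%:R * ln 2 / ln K%:R - 1)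
    (d : measure_display) (Omega : measurableType d) (P : probability Omega R)
    (F : nat -> set (set Omega))
    (That : nat -> Omega -> H -> H) (x y z b xi : nat -> Omega -> H)
    (x0 x1 : H) (x_0 : x 0%N = cst x0) (x_1 : x 1%N = cst x1)
    (sigma : R) (sigma_ge0 : 0 <= sigma)
    (iKM : stochastic_iKM K (sp_alpha K a) (sp_beta K a) (sp_lambda K a)
             That x y z)
    (oracle : stochastic_oracle P K F T That x y z b xi sigma)
    (B_fin : (rms_bias P K b < +oo)%E),
  let residual (v : Omega -> H) := rms P (fun w => v w - T (v w)) in
  (maxe (maxe (residual (x K)) (residual (y K))) (residual (z K)) <=
   C%:E * (((1 + a^-1) / K%:R * inf [set `|x1 - p| | p in Fix T])%:E +
           (1 + a)%:E * ((sigma * ln K%:R / Num.sqrt K%:R)%:E +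
                         rms_bias P K b * (ln K%:R / K%:R)%:E)))%E.
Proof.
pose C : R := Num.sqrt (1000 * expR 46 * (2 * 10 ^+ 6)).
have C_gt0 : 0 < C.
  rewrite sqrtr_gt0; apply: mulr_gt0; first by apply: mulr_gt0; [rewrite ltr0n|exact: expR_gt0].
  by apply: mulr_gt0; [rewrite ltr0n|apply: exprn_gt0; rewrite ltr0n].
exists C; split=> [//|] H dot norm_dot T nT FixT0 K K_ge2 a a_gt0 a_le d Omega P F That
  x y z b xi x0 x1 x_0 x_1 sigma sigma_ge0 iKM oracle B_fin; cbv zeta.
have KK : (1 <= K <= K)%N by rewrite (leq_trans _ K_ge2) /=.
have K0 : 0 < K%:R :> R by rewrite ltr0n (leq_trans _ K_ge2).
rewrite (rms_biasE oracle B_fin).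
set Bs := \sum_(1 <= k < K) _.
set rest := (1 + a) * (sigma * ln K%:R / Num.sqrt K%:R + Bs * (ln K%:R / K%:R)).
have beta0 : 0 < (1 + a^-1) / K%:R by rewrite divr_gt0// addr_gt0// invr_gt0.
have bound v : [\/ v = x K, v = y K | v = z K] ->
    (rms P (fun w => v w - T (v w))%R <= (C * ((1 + a^-1) / K%:R * inf [set `|x1 - p| | p in Fix T] + rest))%:E)%E.
  move=> vE; have bnd p (Tp : T p = p) := residual_last norm_dot nT K_ge2 a_gt0 a_le
    x_0 x_1 sigma_ge0 iKM oracle B_fin Tp vE.
  have [p0 Tp0] := FixT0; have [Lv _] := bnd p0 Tp0.
  have Lr : L2 P (fun w => v w - T (v w)).
    by apply: (L2B norm_dot) => //; exact: (L2_nonexp norm_dot).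
  rewrite (rms_sqr Lr) lee_fin.
  (* [C] and the left side do not depend on the fixed point, so solving for the distance exhibits a
     lower bound of all distances [|x1 - p|], which passes to the infimum. *)
  rewrite -ler_pdivrMl// -lerBlDr -ler_pdivrMl//; apply: lb_le_inf.
    by exists `|x1 - p0|, p0.
  move=> _ [p Tp <-]; rewrite ler_pdivrMl// lerBlDr ler_pdivrMl// -lee_fin -(rms_sqr Lr).
  by have [] := bnd p Tp.
rewrite -!(EFinM, EFinD) -/rest !ge_max.
by rewrite !bound//; [constructor 3|constructor 2|constructor 1].
Qed.
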